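(* Let $d\ge 3$ and let $\{\overline{B}(c_n,r_n)\}_{n\ge 1}$ be a countable collection of non-overlapping (pairwise disjoint) closed balls in $\mathbb{R}^d$ with radii $r_n>0$, such that $\Omega=\mathbb{R}^d\setminus\bigcup_{n\ge 1}\overline{B}(c_n,r_n)$ is a region with $0\in\Omega$. Assume that there is a positive number $\epsilon$ such that $|c_n-c_m|\ge 2\epsilon$ for all $n\ne m$, and that there is a number $M$ such that $$r_n^{d-2}|c_n|^2\le M\quad\text{for all } n\ge 1.$$ If the collection of balls $\{\overline{B}(c_n,r_n)\}_{n\ge 1}$ is avoidable, then $$\sum_{n=1}^\infty\left(\frac{r_n}{|c_n|}\right)^{d-2}<\infty.$$
   Context: $\overline{B}(c,r)$ denotes the closed ball in $\mathbb{R}^d$ with centre $c$ and radius $r$. A region is a connected open set. The collection of balls is called avoidable if there is a positive probability that Brownian motion in $\mathbb{R}^d$ started from $0$ never hits any of the balls. *)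

(* Defs.v *)
From HB Require Import structures.
From mathcomp Require Import all_boot all_order all_algebra.
From mathcomp Require Import all_classical all_reals all_analysis.

Set Implicit Arguments.
Unset Strict Implicit.
Unset Printing Implicit Defensive.

Import Order.TTheory GRing.Theory Num.Theory.
Import numFieldNormedType.Exports.

Local Open Scope classical_set_scope.
Local Open Scope ring_scope.

(* The canonical norm on ['rV[R]_d] is the sup norm, so the Euclidean norm has
   to be introduced separately; both induce the same topology, hence the
   library's [open], [connected] and Borel sets on ['rV[R]_d] are the usual
   ones of R^d. *)
Definition enorm (R : realType) (d : nat) (x : 'rV[R]_d) : R :=
  Num.sqrt (\sum_(i < d) x 0 i ^+ 2).

(* The library's [closed_ball] is relative to the sup norm. *)
Definition cball (R : realType) (d : nat) (c : 'rV[R]_d) (r : R) :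
    set 'rV[R]_d :=
  [set x | enorm (x - c) <= r].

Definition region (T : topologicalType) (A : set T) : Prop :=
  open A /\ connected A.

Definition borel (T : topologicalType) : set (set T) := <<s @open T >>.

Definition increment (R : realType) (d : nat) (T : Type)
    (B : R -> T -> 'rV[R]_d) (s t : R) (w : T) : 'rV[R]_d := B t w - B s w.

(* Only the times [t >= 0] are relevant. Continuity is required of every path,
   so that the event of never hitting a given closed set is measurable. *)
Record brownian_motion (R : realType) (d : nat) (disp : measure_display)
    (T : measurableType disp) (P : probability T R)
    (B : R -> T -> 'rV[R]_d) : Prop := BrownianMotion {
  bm_start : forall w : T, B 0 w = 0 ;
  bm_continuous : forall w : T, {within `[0, +oo[, continuous (fun t : R => B t w)} ;
  bm_measurable : forall (t : R) (i : 'I_d), 0 <= t ->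
    measurable_fun [set: T] (fun w => B t w 0 i) ;
  (* The [A k] may be the whole space, so the product rule for the full family
     of increments is mutual independence. *)
  bm_indep : forall (n : nat) (t : nat -> R) (A : 'I_n -> set 'rV[R]_d),
    0 <= t 0%N ->
    (forall k, (k < n)%N -> t k <= t k.+1) ->
    (forall k, borel (A k)) ->
    P [set w | forall k : 'I_n, A k (increment B (t k) (t k.+1) w)] =
    (\prod_(k < n) P [set w | A k (increment B (t k) (t k.+1) w)])%E ;
  (* [B t - B s] has law N(0, (t - s) I_d): measurable rectangles determine
     the law, and the second parameter of [normal_prob] is the standard
     deviation. Strictness of [s < t] matters, as the library's degenerate
     [normal_prob m 0] is not a Dirac mass. *)
  bm_gaussian : forall (s t : R) (A : 'I_d -> set R),
    0 <= s -> s < t ->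
    (forall i, measurable (A i)) ->
    P [set w | forall i, A i (increment B s t w 0 i)] =
    (\prod_(i < d) normal_prob 0%R (Num.sqrt (t - s)%R) (A i))%E }.

Definition never_hits (R : realType) (d : nat) (T : Type)
    (B : R -> T -> 'rV[R]_d) (c : nat -> 'rV[R]_d) (r : nat -> R) : set T :=
  [set w | forall t : R, 0 <= t -> forall n : nat, ~ cball (c n) (r n) (B t w)].

(* All Brownian motions started from 0 have the same law, so the choice of the
   probability space and of the process is immaterial. *)
Definition avoidable (R : realType) (d : nat) (c : nat -> 'rV[R]_d)
    (r : nat -> R) : Prop :=
  exists (disp : measure_display) (T : measurableType disp)
    (P : probability T R) (B : R -> T -> 'rV[R]_d),
    brownian_motion P B /\ (0 < P (never_hits B c r))%E.

(* Main.v *)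
Require Import Defs.
From mathcomp Require Import all_boot all_order all_algebra.
From mathcomp Require Import all_classical all_reals all_analysis.
From mathcomp Require Import measurable_realfun.
From mathcomp Require Import ring lra.

Import Order.TTheory GRing.Theory Num.Theory.
Import numFieldNormedType.Exports.

Local Open Scope classical_set_scope.
Local Open Scope ring_scope.

(** Why the theorem holds.  Suppose that the balls are avoided with probability
[p > 0].  The sums of [(r n / `|c n|) ^+ (d - 2)] over finite families of distant balls are
bounded by a second moment argument, in the manner of Kochen and Stone, with
constants which do not depend on the family.

Brownian motion is observed at the times [h, 2 * h, .., N * h] only.  In the ball [n] one
inscribes a cube of half-side [a n] proportional to [r n], and every visit to this
cube at one of the times is given the weight [h / a n ^+ 2].  The expected weight
[occ n] of the visits to the cube [n] is a discrete Green function, at least a constant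
times [(a n / `|c n|) ^+ (d - 2)] ([occ_lower]).  Let [S] be the total weight of the visits
and [lam] its expectation, the sum of the [occ n].  As [S] vanishes when the
balls are avoided, [lam ^+ 2 * (1 + p)] is at most the expectation of [S ^+ 2]
([second_moment]).

That expectation is a sum over pairs of visits.  By independence of the
increments ([pr_hit_hit]) it is at most a multiple of [lam], for simultaneous visits, plus
twice the sum of [occ n * visit n m], where [visit n m] bounds the expected weight of the
visits to [m] that follow a visit to [n].  There are three regimes.
- [m = n]: [visit n n] is bounded ([visit_self]).
- [m] differs from [n] and is at most [L] times farther from the origin: the sum of
  [visit n m] over these [m] is bounded ([visit_near]).  This follows from the
  separation of the centres and from the bound on [r m ^+ (d - 2) * `|c m| ^+ 2].
- [m] is more than [L] times farther than [n]: seen from the cube [m], starting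
  from the cube [n] or from the origin is almost the same, and
  [visit n m <= (1 + delta) * occ m] with [delta] small when [L] is large ([visit_far]).
In the last regime the pairs [(n, m)] and [(m, n)] do not both occur, so that twice the
sum of [occ n * occ m] is at most [lam ^+ 2] ([pair_sum_le_sqr]).  Altogether
[lam ^+ 2 * (1 + p) <= C * lam + (1 + delta) * lam ^+ 2].  With [delta = p / 2] this bounds
[lam] by [2 * C / p] ([hit_estimate]), and the sum over distant balls with it.  The
remaining balls have centres in a bounded region, hence are boundedly many
([card_packing]).

All estimates use the sup norm of ['rV[R]_d], under which the cubes are balls; it is
comparable to the Euclidean norm. *)

Set Implicit Arguments.
Unset Strict Implicit.
Unset Printing Implicit Defensive.

(** * Masses of intervals under centred normal laws *)

Section NormalInterval.
Variable R : realType.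
Implicit Types (s y b m : R).

Definition gmass s y b : R :=
  fine (normal_prob 0 s [set` `[y - b, y + b[]).

Lemma gmass_fin s y b :
  (gmass s y b)%:E = normal_prob 0 s [set` `[y - b, y + b[].
Proof. by rewrite /gmass fineK// fin_num_measure. Qed.

Lemma gmass_ge0 s y b : 0 <= gmass s y b.
Proof. by rewrite -lee_fin gmass_fin measure_ge0. Qed.

Lemma gmass_le1 s y b : gmass s y b <= 1.
Proof. by rewrite -lee_fin gmass_fin probability_le1. Qed.

Lemma normal_pdf0E s x : s != 0 ->
  normal_pdf 0 s x = normal_peak s * expR (- (x ^+ 2 / (2 * s ^+ 2))).
Proof.
by move=> s0; rewrite normal_pdfE// /normal_fun subr0 mulNr mulr_natl.
Qed.

Let mu_itv y b : 0 <= b ->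
  lebesgue_measure ([set` `[y - b, y + b[] : set R) = (2 * b)%:E.
Proof.
move=> b0; rewrite lebesgue_measure_itv/= lte_fin.
have -> : (y - b < y + b) = (0 < b) by apply/idP/idP; lra.
case: ltP => hb; first by congr EFin; ring.
by have -> : b = 0 by [lra]; rewrite mulr0.
Qed.

Lemma gmass_le s y b m : 0 < s -> 0 <= b ->
  (forall x, y - b <= x < y + b -> m <= x ^+ 2) ->
  gmass s y b <= 2 * b * normal_peak s * expR (- (m / (2 * s ^+ 2))).
Proof.
move=> s0 b0 H; rewrite -lee_fin gmass_fin /normal_prob.
set I := [set` `[y - b, y + b[].
have mI : measurable (I : set (measurableTypeR R)) by exact: measurable_itv.
apply: (@le_trans _ _ (\int[lebesgue_measure]_(x in I)
   (cst (normal_peak s * expR (- (m / (2 * s ^+ 2))))%:E x))%E).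
  apply: ge0_le_integral => //.
  - by move=> x _; rewrite lee_fin normal_pdf_ge0.
  - by apply/measurable_EFinP; apply: measurable_funTS; exact: measurable_normal_pdf.
  - move=> x; rewrite /I/= in_itv/= => hx.
    rewrite [leLHS]/= [leRHS]/= lee_fin normal_pdf0E ?gt_eqF// ler_wpM2l ?normal_peak_ge0//.
    rewrite ler_expR lerN2 ler_wpM2r ?invr_ge0 ?H//.
    by rewrite mulr_ge0// sqr_ge0.
by rewrite /I integral_cst//= mu_itv// -EFinM lee_fin mulrC !mulrA.
Qed.

Lemma gmass_ge s y b m : 0 < s -> 0 <= b ->
  (forall x, y - b <= x < y + b -> x ^+ 2 <= m) ->
  2 * b * normal_peak s * expR (- (m / (2 * s ^+ 2))) <= gmass s y b.
Proof.
move=> s0 b0 H; rewrite -lee_fin gmass_fin /normal_prob.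
set I := [set` `[y - b, y + b[].
have mI : measurable (I : set (measurableTypeR R)) by exact: measurable_itv.
apply: (@le_trans _ _ (\int[lebesgue_measure]_(x in I)
   (cst (normal_peak s * expR (- (m / (2 * s ^+ 2))))%:E x))%E).
  by rewrite /I integral_cst//= mu_itv// -EFinM lee_fin [leRHS]mulrC !mulrA.
apply: ge0_le_integral => //.
- by move=> x _; rewrite lee_fin mulr_ge0 ?normal_peak_ge0 ?expR_ge0.
- by apply/measurable_EFinP; apply: measurable_funTS; exact: measurable_normal_pdf.
- move=> x; rewrite /I/= in_itv/= => hx.
  rewrite [leLHS]/= [leRHS]/= lee_fin normal_pdf0E ?gt_eqF// ler_wpM2l ?normal_peak_ge0//.
  rewrite ler_expR lerN2 ler_wpM2r ?invr_ge0 ?H//.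
  by rewrite mulr_ge0// sqr_ge0.
Qed.

Definition gpeak : R := (Num.sqrt (2 * pi))^-1.

Lemma gpeak_gt0 : 0 < gpeak.
Proof. by rewrite invr_gt0 sqrtr_gt0 mulr_gt0// pi_gt0. Qed.

Lemma gpeak_le1 : gpeak <= 1.
Proof.
rewrite /gpeak invf_le1 ?sqrtr_gt0 ?mulr_gt0 ?pi_gt0//.
rewrite -[leLHS](sqrtr1 R) ler_wsqrtr//.
by have := pi_ge2 R; lra.
Qed.

Lemma normal_peakE s : 0 < s -> normal_peak s = gpeak / s.
Proof.
move=> s0; rewrite /normal_peak /gpeak -mulr_natl mulrCA sqrtrM ?sqr_ge0//.
by rewrite sqrtr_sqr gtr0_norm// invfM mulrC.
Qed.

(** Both masses are compared with extreme values of the density, so the ratio of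
    the masses is the ratio of the lengths times a factor [expR q] that measures
    how much the squared distance to the origin varies over the two intervals. *)
Lemma gmass_cmp s y y' b b' m m' q : 0 < s -> 0 < b -> 0 <= b' ->
  (forall x, y - b <= x < y + b -> x ^+ 2 <= m) ->
  (forall x, y' - b' <= x < y' + b' -> m' <= x ^+ 2) ->
  m <= m' + 2 * s ^+ 2 * q ->
  gmass s y' b' <= b' / b * expR q * gmass s y b.
Proof.
move=> s0 b0 b'0 hm hm' mm'.
have s20 : 0 < 2 * s ^+ 2 by rewrite mulr_gt0// exprn_gt0.
apply: (le_trans (gmass_le s0 b'0 hm')).
apply: (le_trans _ (ler_wpM2l _ (gmass_ge s0 (ltW b0) hm))); last first.
  by rewrite mulr_ge0 ?expR_ge0// divr_ge0// ltW.
rewrite [leRHS](_ : _ = 2 * b' * normal_peak s *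
    (expR q * expR (- (m / (2 * s ^+ 2))))); last by field; rewrite gt_eqF.
apply: ler_wpM2l; first by rewrite !mulr_ge0// normal_peak_ge0.
rewrite -expRD ler_expR lerBrDr addrC -lerBrDr opprK.
by rewrite ler_pdivrMr// mulrDl divfK ?gt_eqF// addrC mulrC; lra.
Qed.

End NormalInterval.

(** * Masses of cubes under isotropic normal laws *)

Section GaussianBox.
Variables (R : realType) (d : nat).
Implicit Types (s b q : R) (y : 'rV[R]_d).

(** The probability that Brownian motion moves by a vector of the cube of centre
    [y] and half-side [b] during a time of square root [s]. *)
Definition gbox s y b : R := \prod_(i < d) gmass s (y 0 i) b.

Lemma gbox_ge0 s y b : 0 <= gbox s y b.
Proof. by apply: prodr_ge0 => i _; exact: gmass_ge0. Qed.

Lemma gbox_le1 s y b : gbox s y b <= 1.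
Proof. by apply: prodr_ile1 => i _; rewrite gmass_ge0 gmass_le1. Qed.

Lemma norm_coord_le y i : `|y 0 i| <= `|y|.
Proof.
rewrite [leRHS]/Num.Def.normr/= mx_normrE.
by apply: (le_bigmax_cond _ (fun ij : 'I_1 * 'I_d => `|y ij.1 ij.2|) (j := (0, i))).
Qed.

Lemma norm_coord_eq y : y != 0 -> exists i, `|y| = `|y 0 i|.
Proof.
move=> y0; have : mx_norm y != 0 by apply: contra_neq y0 => /mx_norm_eq0.
by move=> /mx_norm_neq0[[i j]]/= yE; exists j; rewrite [LHS]yE (ord1 i).
Qed.

Lemma norm_le_coord y m : 0 <= m -> (forall i, `|y 0 i| <= m) -> `|y| <= m.
Proof.
move=> m0 H; have [->|/norm_coord_eq[i ->]//] := eqVneq y 0.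
by rewrite normr0.
Qed.

Lemma gmass_le_peak s x b : 0 < s -> 0 <= b -> gmass s x b <= 2 * b / s.
Proof.
move=> s0 b0; apply: (le_trans (gmass_le (m := 0) s0 b0 _)).
  by move=> *; exact: sqr_ge0.
rewrite mul0r oppr0 expR0 mulr1 normal_peakE// mulrA ler_wpM2r ?invr_ge0 ?(ltW s0)//.
by rewrite ler_piMr ?gpeak_le1// mulr_ge0.
Qed.

Lemma gbox_le_peak s y b : 0 < s -> 0 <= b -> gbox s y b <= (2 * b / s) ^+ d.
Proof.
move=> s0 b0; rewrite -[d in leRHS]card_ord -prodr_const.
by apply: ler_prod => i _; rewrite gmass_ge0 gmass_le_peak.
Qed.

(** One coordinate of the centre realises the sup norm, and on the whole cube
    that coordinate stays above half of it: this single factor already provides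
    the Gaussian decay. *)
Lemma gbox_far s y b rho : 0 < s -> 0 <= b -> 0 < rho <= `|y| ->
  2 * b <= `|y| ->
  gbox s y b <= (2 * b / s) ^+ d * expR (- (rho ^+ 2 / (8 * s ^+ 2))).
Proof.
move=> s0 b0 /andP[rho0 rhoy] by2.
have [|i0 yi0] := @norm_coord_eq y.
  by rewrite -normr_gt0 (lt_le_trans rho0).
set e := expR _.
have -> : (2 * b / s) ^+ d * e =
    \prod_(i < d) (2 * b / s * (if i == i0 then e else 1)).
  by rewrite big_split/= prodr_const card_ord -big_mkcond/= big_pred1_eq.
apply: ler_prod => i _; rewrite gmass_ge0/=; case: eqP => [->|_]; last first.
  by rewrite mulr1 gmass_le_peak.
apply: (le_trans (gmass_le (m := rho ^+ 2 / 4) s0 b0 _)); last first.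
  rewrite [X in expR X](_ : _ = - (rho ^+ 2 / (8 * s ^+ 2))); last first.
    by field; rewrite gt_eqF.
  rewrite ler_wpM2r ?expR_ge0// normal_peakE// mulrA.
  by rewrite ler_wpM2r ?invr_ge0 ?(ltW s0)// ler_piMr ?gpeak_le1// mulr_ge0.
move=> x /andP[hx1 hx2]; have h2 : rho / 2 <= `|x|.
  rewrite yi0 in rhoy by2; move: rhoy by2.
  by case: (ger0P (y 0 i0)) => ?; case: (ger0P x) => ?; lra.
have -> : rho ^+ 2 / 4 = (rho / 2) ^+ 2 by field.
by rewrite -(real_normK (num_real x)) ler_sqr// nnegrE// ltW// divr_gt0.
Qed.

Lemma exp_pow_bound (z : R) : 0 <= z -> z ^+ d <= (8 * d%:R) ^+ d * expR (z / 8).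
Proof.
case: (posnP d) => [->|d0] z0.
  by rewrite !expr0 mul1r -expR0 ler_expR divr_ge0.
have dr : 0 < d%:R :> R by rewrite ltr0n.
have -> : z / 8 = d%:R * (z / (8 * d%:R)) by field; rewrite gt_eqF.
rewrite expRM_natl -exprMn ler_pXn2r ?nnegrE ?mulr_ge0 ?expR_ge0//.
rewrite -ler_pdivrMl ?mulr_gt0// mulrC.
by apply: le_trans (expR_ge1Dx _); rewrite lerDr.
Qed.

Definition gboxC : R := 2 * (16 * d%:R) ^+ d.

Lemma gboxC_ge0 : 0 <= gboxC.
Proof. by rewrite mulr_ge0// exprn_ge0// mulr_ge0. Qed.

(** A bound with the right size for short and for long times: for [s <= rho] the
    cube is either far, and the exponential wins over [(rho / s) ^+ d], or of
    half-side at least [rho], and then a probability is at most [1]; for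
    [rho <= s] the density is at most of order [s ^- d].  Summed over time it
    yields every upper bound on the Green function that is needed. *)
Lemma gbox_le s y b rho q : (0 < d)%N -> 0 < s -> 0 <= b -> 0 < rho -> 0 < q ->
  q ^+ 2 = rho ^+ 2 + s ^+ 2 ->
  (rho <= `|y| /\ 2 * b <= `|y|) \/ rho <= b ->
  gbox s y b <= gboxC * (b / q) ^+ d.
Proof.
move=> d0 s0 b0 rho0 q0 qE; have d1 : 1 <= d%:R :> R by rewrite ler1n.
case=> [[ry by2]|rb].
  have H := gbox_far s0 b0 _ by2.
  have {}H := H rho; rewrite rho0 ry in H; have {H}H := H isT.
  apply: (le_trans H).
  pose z := q ^+ 2 / s ^+ 2.
  have z1 : 1 <= z.
    by rewrite ler_pdivlMr ?exprn_gt0// mul1r qE lerDr sqr_ge0.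
  have -> : rho ^+ 2 / (8 * s ^+ 2) = z / 8 - 1 / 8.
    by rewrite /z qE; field; rewrite gt_eqF.
  have qs : q / s <= z.
    have -> : z = (q / s) ^+ 2 by rewrite /z expr_div_n.
    have sq0 : 0 <= q / s by rewrite divr_ge0// ltW.
    by rewrite ler_eXnr// -(@expr_ge1 _ 2)// expr_div_n.
  (* expR x <= 1 / (1 - x) at x = 1 / 8 *)
  have e18 : expR (1 / 8) <= 2 :> R.
    have : 1 - 1 / 8 <= expR (- (1 / 8)) :> R by exact: expR_ge1Dx.
    rewrite expRN; have := expR_gt0 (1 / 8 : R); set E := expR _ => E0 hE.
    have : E * (1 - 1 / 8) <= E * E^-1 by rewrite ler_wpM2l// ltW.
    by rewrite divff ?gt_eqF//; lra.
  rewrite opprB expRD expRN.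
  have zd : (q / s) ^+ d <= (8 * d%:R) ^+ d * expR (z / 8).
    apply: le_trans (exp_pow_bound (le_trans ler01 z1)).
    apply: lerXn2r => //; rewrite nnegrE.
      by rewrite divr_ge0// ltW.
    exact: le_trans ler01 z1.
  have -> : (2 * b / s) ^+ d = (2 * b / q) ^+ d * (q / s) ^+ d.
    by rewrite -exprMn mulrA divfK ?gt_eqF.
  apply: (@le_trans _ _ ((2 * b / q) ^+ d * ((8 * d%:R) ^+ d * expR (z / 8)) *
      (2 * (expR (z / 8))^-1))).
    apply: ler_pM.
    - by rewrite mulr_ge0 ?exprn_ge0 ?divr_ge0 ?mulr_ge0// ltW.
    - by rewrite mulr_ge0 ?expR_ge0// invr_ge0 expR_ge0.
    - by rewrite ler_wpM2l// exprn_ge0// divr_ge0 ?mulr_ge0// ltW.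
    - by rewrite ler_wpM2r// invr_ge0 expR_ge0.
  rewrite le_eqVlt; apply/orP; left; apply/eqP.
  rewrite /gboxC (_ : 16 * d%:R = 2 * (8 * d%:R)); last by ring.
  rewrite (_ : 2 * b / q = 2 * (b / q)); last by rewrite mulrA.
  rewrite !exprMn -/(z); have := expR_gt0 (z / 8); set E := expR _ => E0.
  by rewrite mulrCA; field; rewrite ?(gt_eqF E0) ?gt_eqF.
have H4 : gbox s y b <= (4 * b / q) ^+ d.
  have [sb|bs] := lerP s b.
    apply: (le_trans (gbox_le1 _ _ _)); rewrite exprn_ege1//.
    rewrite ler_pdivlMr// mul1r -(@ler_pXn2r _ 2)// ?nnegrE ?mulr_ge0// ?ltW//.
    by rewrite qE; nra.
  apply: (le_trans (gbox_le_peak _ s0 b0)).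
  apply: lerXn2r; rewrite ?nnegrE ?divr_ge0 ?mulr_ge0 ?(ltW s0) ?(ltW q0)//.
  rewrite ler_pdivrMr// mulrAC ler_pdivlMr//.
  have : q <= 2 * s.
    by rewrite -(@ler_pXn2r _ 2)// ?nnegrE ?mulr_ge0// ?ltW// qE; nra.
  by move=> h; rewrite (_ : 4 * b * s = 2 * b * (2 * s)); [|ring]; rewrite ler_wpM2l// mulr_ge0.
apply: (le_trans H4); rewrite -mulrA exprMn ler_wpM2r//.
  by rewrite exprn_ge0// divr_ge0// ltW.
rewrite /gboxC -[leLHS]mul1r ler_pM ?exprn_ge0 ?ler1n// lerXn2r// ?nnegrE ?mulr_ge0//.
by nra.
Qed.

Lemma gbox_le_time t y b rho : (0 < d)%N -> 0 < t -> 0 <= b -> 0 < rho ->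
  (rho <= `|y| /\ 2 * b <= `|y|) \/ rho <= b ->
  gbox (Num.sqrt t) y b <= gboxC * (b / Num.sqrt (rho ^+ 2 + t)) ^+ d.
Proof.
move=> d0 t0 b0 rho0 H.
have q0 : 0 < rho ^+ 2 + t by rewrite addr_gt0 ?exprn_gt0.
apply: (@gbox_le _ y b rho) => //; rewrite ?sqrtr_gt0//.
by rewrite sqr_sqrtr ?(ltW q0)// sqr_sqrtr ?(ltW t0).
Qed.

Lemma gbox_ge s y b Y : 0 < s -> 0 <= b <= Y -> `|y| <= Y -> Y <= s ->
  (2 * b * (gpeak R / s) * expR (- 2)) ^+ d <= gbox s y b.
Proof.
move=> s0 /andP[b0 bY] yY Ys.
rewrite -[d in leLHS]card_ord -prodr_const; apply: ler_prod => i _.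
rewrite !mulr_ge0 ?expR_ge0 ?invr_ge0 ?(ltW s0) ?(ltW (gpeak_gt0 R))//=.
have := @gmass_ge R s (y 0 i) b (4 * s ^+ 2) s0 b0.
rewrite -normal_peakE//.
have -> : 4 * s ^+ 2 / (2 * s ^+ 2) = 2 by field; rewrite gt_eqF.
apply => x /andP[hx1 hx2].
have yi := le_trans (norm_coord_le y i) yY.
have : `|x| <= 2 * s.
  rewrite ler_norml; move: yi; rewrite ler_norml => /andP[? ?].
  by apply/andP; split; lra.
move=> h; rewrite -(real_normK (num_real x)).
rewrite (_ : 4 * s ^+ 2 = (2 * s) ^+ 2); last by ring.
by rewrite ler_sqr ?nnegrE// mulr_ge0// ltW.
Qed.

(** When both cubes are small and close together compared to [rho], the squared
    norm varies by at most [6 * eta * rho ^+ 2] over them.  Moving the centre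
    therefore changes the mass by a factor that tends to [1] with [eta], as long
    as [s] is not much smaller than [rho]. *)
Lemma gbox_cmp s y y' b b' rho eta : 0 < s -> 0 < b -> 0 <= b' -> 0 <= rho ->
  0 <= eta <= 2 / 3 -> b <= eta * rho -> b' <= eta * rho ->
  `|y| <= rho -> `|y' - y| <= eta * rho ->
  gbox s y' b' <=
    (b' / b) ^+ d * expR (d%:R * (3 * eta * (rho / s) ^+ 2)) * gbox s y b.
Proof.
move=> s0 b0 b'0 rho0 /andP[eta0 eta23] be b'e yrho yy'.
rewrite expRM_natl -exprMn -[d in (_ * _) ^+ d]card_ord -prodr_const -big_split/=.
apply: ler_prod => i _; rewrite gmass_ge0/=.
have er0 : 0 <= eta * rho by rewrite mulr_ge0.
have yi := le_trans (norm_coord_le y i) yrho.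
have := le_trans (norm_coord_le (y' - y) i) yy'; rewrite !mxE => yy'i.
set u := `|y 0 i|; set e := eta * rho.
apply: (@gmass_cmp _ _ _ _ _ _ ((u + e) ^+ 2) (Num.max 0 (u - 2 * e) ^+ 2)) => //.
- move=> x /andP[hx1 hx2]; rewrite -(real_normK (num_real x)).
  rewrite ler_sqr ?nnegrE ?addr_ge0 ?normr_ge0//.
  rewrite /u /e ler_norml; move: (ler_norm (y 0 i)) (ler_norm (- y 0 i)).
  by rewrite normrN => ? ?; apply/andP; split; lra.
- move=> x /andP[hx1 hx2]; rewrite -(real_normK (num_real x)) ler_sqr ?nnegrE ?le_max ?lexx//.
  rewrite ge_max normr_ge0/=.
  move: yy'i; rewrite ler_norml -/u => /andP[? ?].
  by rewrite /u /e; case: (ger0P (y 0 i)) => ?; case: (ger0P x) => ?; lra.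
have -> : 2 * s ^+ 2 * (3 * eta * (rho / s) ^+ 2) = 6 * e * rho.
  by rewrite /e; field; rewrite gt_eqF.
have u0 : 0 <= u by exact: normr_ge0.
have eR : e <= 2 / 3 * rho by rewrite ler_wpM2r.
rewrite -/u in yi.
have p1 : 0 <= e * (rho - u) by rewrite mulr_ge0// subr_ge0.
have p2 : 0 <= e * (2 / 3 * rho - e) by rewrite mulr_ge0// subr_ge0.
case: (lerP 0 (u - 2 * e)) => h.
  by have p3 : 0 <= e * e by [rewrite mulr_ge0]; lra.
have p3 : 0 <= (2 * e - u) * (4 * e + u).
  by rewrite mulr_ge0//; lra.
by rewrite expr0n/=; lra.
Qed.

End GaussianBox.

(** * Discrete Green functions *)

Section TimeSums.
Variables (R : realType) (h : R).
Hypothesis h_gt0 : 0 < h.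
Implicit Types (N k : nat) (T rho : R).

Definition gtime k : R := k.+1%:R * h.

Lemma gtime_gt0 k : 0 < gtime k.
Proof. by rewrite mulr_gt0// ltr0n. Qed.

(** The sum is compared with the integral of [(rho ^+ 2 + t) ^ (- 3 / 2)], whose
    primitive is [- 2 / Num.sqrt (rho ^+ 2 + t)]: the bound telescopes, whatever the
    size of the step [h]. *)
Lemma sum_inv_cube N rho : 0 < rho ->
  \sum_(k < N) h / Num.sqrt (rho ^+ 2 + gtime k) ^+ 3 <= 2 / rho.
Proof.
move=> rho0.
suff : \sum_(k < N) h / Num.sqrt (rho ^+ 2 + gtime k) ^+ 3 <=
    2 / rho - 2 / Num.sqrt (rho ^+ 2 + N%:R * h).
  by move/le_trans; apply; rewrite lerBlDr lerDl divr_ge0.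
elim: N => [|N IH].
  by rewrite big_ord0 mul0r addr0 sqrtr_sqr gtr0_norm// subrr.
rewrite big_ord_recr/=; apply: (le_trans (lerD IH (lexx _))).
set p := Num.sqrt (_ + N%:R * h); rewrite -/(gtime N).
set q := Num.sqrt (_ + gtime N).
have p0 : 0 < p by rewrite sqrtr_gt0 ltr_wpDr ?exprn_gt0// mulr_ge0// ltW.
have q0 : 0 < q by rewrite sqrtr_gt0 ltr_wpDr ?exprn_gt0// ltW// gtime_gt0.
have hE : h = q ^+ 2 - p ^+ 2.
  rewrite !sqr_sqrtr ?addr_ge0 ?sqr_ge0 ?(ltW (gtime_gt0 _)) ?mulr_ge0 ?(ltW h_gt0)//.
  by rewrite /gtime -[N.+1]addn1 natrD; ring.
have pq : p < q by have := h_gt0; rewrite hE subr_gt0 ltr_pXn2r ?nnegrE ?ltW.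
suff : h / q ^+ 3 <= 2 / p - 2 / q by lra.
rewrite -subr_ge0 hE.
have -> : 2 / p - 2 / q - (q ^+ 2 - p ^+ 2) / q ^+ 3 =
   (q - p) * (2 * q ^+ 2 - p * q - p ^+ 2) / (p * q ^+ 3).
  by field; rewrite !gt_eqF.
rewrite divr_ge0 ?mulr_ge0 ?exprn_ge0 ?subr_ge0 ?(ltW p0) ?(ltW q0) ?(ltW pq)//.
by nra.
Qed.

Lemma sum_time_lt N T : 0 <= T -> \sum_(k < N | gtime k < T) h <= T.
Proof.
move=> T0.
suff [] : \sum_(k < N | gtime k < T) h <= T /\
          \sum_(k < N | gtime k < T) h <= N%:R * h by [].
elim: N => [|N [IH1 IH2]]; first by rewrite big_ord0 mul0r.
rewrite big_mkcond big_ord_recr/= -big_mkcond/=.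
case: ltP => hN; last first.
  by rewrite addr0; split=> //; apply: (le_trans IH2); rewrite ler_wpM2r ?ltW// ltr_nat.
have : \sum_(k < N | gtime k < T) h + h <= N.+1%:R * h.
  by rewrite -[N.+1]addn1 natrD mulrDl mul1r lerD2r.
by split=> //; apply: le_trans (ltW hN).
Qed.

Lemma sum_time_le N T : T <= N%:R * h ->
  T - h <= \sum_(k < N | gtime k <= T) h.
Proof.
move=> TN.
suff : T - h <= \sum_(k < N | gtime k <= T) h \/
       (N%:R * h <= T /\ N%:R * h <= \sum_(k < N | gtime k <= T) h).
  by case=> // -[_]; apply: le_trans; have := h_gt0; lra.
elim: N {TN} => [|N IH].
  by rewrite big_ord0 mul0r; case: (lerP 0 T) => ?; [right|left]; have := h_gt0; lra.
rewrite big_mkcond big_ord_recr/= -big_mkcond/= -/(gtime N).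
case: (lerP (gtime N) T) => hN; rewrite ?addr0.
  right; split => //; case: IH => [|[_]].
    have : gtime N <= T by [].
    by rewrite /gtime -[N.+1]addn1 natrD; lra.
  by rewrite /gtime -[N.+1]addn1 natrD; lra.
left; case: IH => // -[_]; move: hN.
by rewrite /gtime -[N.+1]addn1 natrD; lra.
Qed.

Section Green.
Variable D : nat.
Local Notation d := D.+3.

(** Three of the [d] factors make the sum over time converge; the others are
    at most [b / rho].  This is where [d >= 3], i.e. transience, enters. *)
Lemma green_le N rho b (U : nat -> R) : 0 < rho -> 0 <= b ->
  (forall k, (k < N)%N ->
    U k <= gboxC R d * (b / Num.sqrt (rho ^+ 2 + gtime k)) ^+ d) ->
  \sum_(k < N) h * U k <= 2 * gboxC R d * b ^+ d / rho ^+ D.+1.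
Proof.
move=> rho0 b0 HU.
have C0 := gboxC_ge0 R d.
apply: (@le_trans _ _ (\sum_(k < N) gboxC R d * b ^+ d / rho ^+ D *
    (h / Num.sqrt (rho ^+ 2 + gtime k) ^+ 3))); last first.
  rewrite -mulr_sumr.
  apply: (le_trans (ler_wpM2l _ (sum_inv_cube N rho0))).
    by apply: divr_ge0; [apply: mulr_ge0 => //; exact: exprn_ge0|exact/exprn_ge0/ltW].
  rewrite le_eqVlt; apply/orP; left; apply/eqP; rewrite [rho ^+ D.+1]exprS.
  by field; rewrite !gt_eqF ?exprn_gt0.
apply: ler_sum => k _.
have := HU k (ltn_ord k).
set q := Num.sqrt _ => Uk.
have rq : rho <= q.
  rewrite -[leLHS]gtr0_norm// -sqrtr_sqr ler_wsqrtr// lerDl.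
  by rewrite ltW// gtime_gt0.
have q0 := lt_le_trans rho0 rq.
apply: (le_trans (ler_wpM2l (ltW h_gt0) Uk)).
have -> : h * (gboxC R d * (b / q) ^+ d) =
    gboxC R d * b ^+ d * (h / q ^+ 3) * (q ^+ D)^-1.
  rewrite expr_div_n (_ : q ^+ d = q ^+ D * q ^+ 3); last by rewrite -exprD addn3.
  have := exprn_gt0 D q0; move: (q ^+ D) (b ^+ d) => A B A0.
  by field; rewrite !gt_eqF.
rewrite mulrAC; apply: ler_wpM2r; first by rewrite divr_ge0 ?exprn_ge0 ?ltW.
apply: ler_wpM2l; first by rewrite mulr_ge0 ?exprn_ge0.
rewrite lef_pV2 ?posrE ?exprn_gt0//.
by apply: lerXn2r; rewrite ?nnegrE ?(ltW rho0) ?(ltW q0).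
Qed.

(** Times short compared to [rho ^+ 2] carry a small part of the Green
    function. *)
Lemma green_short N rho b T (U : nat -> R) : 0 < rho -> 0 <= b -> 0 <= T ->
  (forall k, (k < N)%N ->
    U k <= gboxC R d * (b / Num.sqrt (rho ^+ 2 + gtime k)) ^+ d) ->
  \sum_(k < N | gtime k < T) h * U k <= gboxC R d * (b / rho) ^+ d * T.
Proof.
move=> rho0 b0 T0 HU.
have C0 := gboxC_ge0 R d.
have G0 : 0 <= gboxC R d * (b / rho) ^+ d.
  by rewrite mulr_ge0 ?exprn_ge0 ?divr_ge0// ltW.
apply: (le_trans _ (ler_wpM2l G0 (sum_time_lt N T0))).
rewrite mulr_sumr; apply: ler_sum => k _.
rewrite mulrC ler_wpM2r ?(ltW h_gt0)//; apply: (le_trans (HU k (ltn_ord k))).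
rewrite ler_wpM2l// lerXn2r// ?nnegrE ?divr_ge0 ?sqrtr_ge0 ?(ltW rho0)//.
rewrite ler_wpM2l// lef_pV2 ?posrE// ?sqrtr_gt0 ?addr_gt0 ?exprn_gt0 ?gtime_gt0//.
rewrite -[leLHS]gtr0_norm// -sqrtr_sqr ler_wsqrtr// lerDl.
by rewrite ltW// gtime_gt0.
Qed.

Definition greenc : R := (gpeak R * expR (- 2)) ^+ d / 2.

Lemma greenc_gt0 : 0 < greenc.
Proof. by rewrite divr_gt0// exprn_gt0// mulr_gt0 ?gpeak_gt0 ?expR_gt0. Qed.

(** The times between [rho ^+ 2] and [2 * rho ^+ 2] suffice to give the Green
    function its order of magnitude: there the density is of order [rho ^- d] on
    the whole cube. *)
Lemma green_ge N rho b (y : 'rV[R]_d) : 0 < rho -> 0 <= b <= rho -> `|y| <= rho ->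
  h <= rho ^+ 2 / 2 -> 2 * rho ^+ 2 <= N%:R * h ->
  greenc * b ^+ d / rho ^+ D.+1 <=
  \sum_(k < N) h * gbox (Num.sqrt (gtime k)) y b.
Proof.
move=> rho0 /andP[b0 brho] yrho hrho Nh.
set P := fun k => (rho ^+ 2 <= gtime k) && (gtime k <= 2 * rho ^+ 2).
pose e : R := (b * gpeak R / rho * expR (- 2)) ^+ d.
have e0 : 0 <= e.
  by rewrite exprn_ge0// !mulr_ge0 ?expR_ge0 ?invr_ge0 ?(ltW rho0) ?(ltW (gpeak_gt0 R)).
(* the steps up to time [2 * rho ^+ 2], less those before time [rho ^+ 2] *)
have cnt : rho ^+ 2 / 2 <= \sum_(k < N | P k) h.
  have H1 := sum_time_le Nh.
  have H2 := sum_time_lt N (sqr_ge0 rho).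
  have : \sum_(k < N | gtime k <= 2 * rho ^+ 2) h =
         \sum_(k < N | gtime k < rho ^+ 2) h + \sum_(k < N | P k) h.
    rewrite (bigID (fun k : 'I_N => gtime k < rho ^+ 2))/=; congr (_ + _).
      apply: eq_bigl => k; rewrite andb_idl// => /ltW/le_trans; apply.
      by rewrite ler_peMl ?sqr_ge0// ler1n.
    by apply: eq_bigl => k; rewrite /P -leNgt andbC.
  by move=> E; rewrite E in H1; lra.
apply: (@le_trans _ _ (e * (rho ^+ 2 / 2))).
  rewrite le_eqVlt; apply/orP; left; apply/eqP.
  have -> : e = (gpeak R * expR (- 2)) ^+ d * (b ^+ d / rho ^+ d).
    by rewrite /e -expr_div_n -exprMn; congr (_ ^+ _); ring.
  rewrite /greenc (_ : rho ^+ d = rho ^+ D.+1 * rho ^+ 2); last first.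
    by rewrite -exprD addn2.
  have := exprn_gt0 D.+1 rho0.
  move: (_ ^+ d) (b ^+ d) (rho ^+ D.+1) => A B E E0.
  by field; rewrite !gt_eqF.
apply: (le_trans (ler_wpM2l e0 cnt)).
rewrite mulr_sumr big_mkcond/=; apply: ler_sum => k _.
have g0 : 0 <= h * gbox (Num.sqrt (gtime k)) y b.
  by rewrite mulr_ge0 ?gbox_ge0// ltW.
case: ifP => // /andP[k1 k2].
have s1 : rho <= Num.sqrt (gtime k).
  by rewrite -[leLHS]gtr0_norm// -sqrtr_sqr ler_wsqrtr.
have s2 : Num.sqrt (gtime k) <= 2 * rho.
  rewrite -[leRHS]gtr0_norm ?mulr_gt0// -sqrtr_sqr ler_wsqrtr//.
  by apply: (le_trans k2); rewrite exprMn ler_wpM2r ?sqr_ge0//; lra.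
have s0 := lt_le_trans rho0 s1.
rewrite mulrC ler_wpM2l ?(ltW h_gt0)//.
apply: (le_trans _ (gbox_ge s0 _ yrho s1)); last by rewrite b0.
apply: lerXn2r.
- by rewrite nnegrE !mulr_ge0 ?expR_ge0 ?invr_ge0 ?(ltW rho0) ?(ltW (gpeak_gt0 R)).
- by rewrite nnegrE !mulr_ge0 ?expR_ge0 ?invr_ge0 ?(ltW s0) ?(ltW (gpeak_gt0 R)).
rewrite ler_wpM2r ?expR_ge0// ler_pdivrMr//.
have -> : 2 * b * (gpeak R / Num.sqrt (gtime k)) * rho =
    b * gpeak R * (2 * rho / Num.sqrt (gtime k)) by field; rewrite gt_eqF.
rewrite ler_peMr ?mulr_ge0 ?(ltW (gpeak_gt0 R))//.
by rewrite ler_pdivlMr ?mul1r.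
Qed.

End Green.
End TimeSums.

(** * Sums over separated points *)

Section Packing.
Variables (R : realType) (d : nat) (I : finType) (c : I -> 'rV[R]_d) (e : R).
Hypothesis e_gt0 : 0 < e.
Hypothesis c_sep : forall i j, i != j -> 2 * e <= `|c i - c j|.

(** In a grid of cells of side [e], two distinct points never share a cell, and
    at most [(2 * S / e + 1) ^+ d] cells meet the ball. *)
Lemma card_packing (x : 'rV[R]_d) (S : R) : e <= S ->
  #|[pred i | `|c i - x| <= S]|%:R <= (3 * S / e) ^+ d.
Proof.
move=> eS; have S0 := lt_le_trans e_gt0 eS.
set K := Num.truncn (2 * S / e).
pose u i j : R := (c i 0 j - x 0 j + S) / e.
pose idx i : {ffun 'I_d -> 'I_K.+1} := [ffun j => inord (Num.truncn (u i j))].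
set A := [pred i | _].
have uP i j : i \in A -> 0 <= u i j /\ (Num.truncn (u i j) <= K)%N.
  rewrite inE => iS; have := le_trans (norm_coord_le _ j) iS.
  rewrite !mxE ler_norml => /andP[h1 h2]; split.
    by rewrite divr_ge0 ?(ltW e_gt0)//; lra.
  by apply: le_truncn; rewrite ler_wpM2r ?invr_ge0 ?(ltW e_gt0)//; lra.
have inj : {in A &, injective idx}.
  move=> i j iA jA eqij; apply/eqP; apply: contraT => /c_sep.
  rewrite leNgt => /negP[]; apply: (@le_lt_trans _ _ e); last by have := e_gt0; lra.
  apply: norm_le_coord; first exact: ltW.
  move=> k; have [ui iK] := uP i k iA; have [uj jK] := uP j k jA.
  have := congr1 (fun f : {ffun 'I_d -> 'I_K.+1} => val (f k)) eqij.
  rewrite /= !ffunE !inordK ?ltnS// => tr.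
  have /andP[i1 i2] := truncn_itv ui; have /andP[j1 j2] := truncn_itv uj.
  move: i1 i2; rewrite tr => i1 i2.
  have lt1 : `|u i k - u j k| <= 1.
    move: i2 j2; rewrite -[(Num.truncn _).+1]addn1 natrD => i2 j2.
    by rewrite ler_norml; apply/andP; split; lra.
  have -> : (c i - c j) 0 k = e * (u i k - u j k).
    by rewrite !mxE /u; field; rewrite gt_eqF.
  by rewrite normrM gtr0_norm// ler_piMr// ltW.
have : (#|A| <= K.+1 ^ d)%N.
  have <- : #|{ffun 'I_d -> 'I_K.+1}| = (K.+1 ^ d)%N by rewrite card_ffun !card_ord.
  by rewrite -(card_in_imset inj) max_card.
rewrite -(ler_nat R) natrX => /le_trans; apply.
apply: lerXn2r; rewrite ?nnegrE ?ler0n ?divr_ge0 ?mulr_ge0 ?(ltW S0) ?(ltW e_gt0)//.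
have : K%:R <= 2 * S / e.
  by rewrite /K truncn_le divr_ge0 ?mulr_ge0 ?(ltW S0) ?(ltW e_gt0).
have : 1 <= S / e by rewrite ler_pdivlMr// mul1r.
by rewrite -[K.+1]addn1 natrD; lra.
Qed.

End Packing.

Section PackingSum.
Variables (R : realType) (D : nat) (I : finType) (c : I -> 'rV[R]_D.+1) (e : R).
Hypothesis e_gt0 : 0 < e.
Hypothesis c_sep : forall i j, i != j -> 2 * e <= `|c i - c j|.

Definition packC : R := (6 / e) ^+ D.+1.

Lemma packC_ge0 : 0 <= packC.
Proof. by rewrite exprn_ge0// divr_ge0// ltW. Qed.

(** By dyadic shells: the outer half of the ball contributes at most a constant
    times [S] by [card_packing], and the inner half is the same sum for
    [S / 2]. *)
Lemma sum_dist_max (x : 'rV[R]_D.+1) (S : R) : 0 <= S ->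
  \sum_(i | e <= `|c i - x| <= S) (`|c i - x| ^+ D)^-1 <= packC * S.
Proof.
move=> S0; move: (Num.truncn (S / e)) (truncnS_gt (S / e)) => n nS.
have : S < 2 ^+ n * e.
  rewrite -ltr_pdivrMr//; apply: (lt_le_trans nS).
  by rewrite -natrX ler_nat; exact: ltn_expl.
clear nS; elim: n S S0 => [|n IH] S S0 Sn.
  rewrite mul1r in Sn; rewrite big_pred0 ?mulr_ge0 ?packC_ge0// => i.
  by apply/negbTE/negP => /andP[h1 h2]; have := le_trans h1 h2; rewrite leNgt Sn.
have [Se|eS] := ltP S e.
  rewrite big_pred0 ?mulr_ge0 ?packC_ge0// => i.
  by apply/negbTE/negP => /andP[h1 h2]; have := le_trans h1 h2; rewrite leNgt Se.
have Sp := lt_le_trans e_gt0 eS.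
have S2 : 0 <= S / 2 by rewrite divr_ge0.
have {}IH := IH _ S2.
have {}IH : \sum_(i | e <= `|c i - x| <= S / 2) (`|c i - x| ^+ D)^-1 <= packC * (S / 2).
  by apply: IH; rewrite ltr_pdivrMr// mulrAC -exprSr.
rewrite (bigID (fun i => `|c i - x| <= S / 2))/=.
have -> : packC * S = packC * (S / 2) + packC * (S / 2) by field.
apply: lerD.
  apply: le_trans IH; rewrite le_eqVlt; apply/orP; left; apply/eqP.
  apply: eq_bigl => i; rewrite -andbA; congr (_ && _).
  by rewrite andb_idl// => h; apply: (le_trans h); lra.
apply: (@le_trans _ _ (\sum_(i in [pred i | `|c i - x| <= S]) ((S / 2) ^+ D)^-1)).
  rewrite big_mkcond [leRHS]big_mkcond/=; apply: ler_sum => i _.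
  rewrite inE -ltNge; case: ifP => [/andP[/andP[h1 ->] h3]|_].
    rewrite lef_pV2 ?posrE ?exprn_gt0 ?divr_gt0 ?(lt_le_trans e_gt0 h1)//.
    by apply: lerXn2r; rewrite ?nnegrE// ltW.
  by case: ifP => // _; rewrite invr_ge0 exprn_ge0.
rewrite sumr_const -[leLHS]mulr_natl.
apply: (le_trans (ler_wpM2r _ (card_packing e_gt0 c_sep x eS))).
  by rewrite invr_ge0 exprn_ge0.
rewrite le_eqVlt; apply/orP; left; apply/eqP.
have -> : 3 * S / e = 6 / e * (S / 2) by field; rewrite gt_eqF.
rewrite exprMn -/packC [(S / 2) ^+ D.+1]exprS -!mulrA mulfV ?mulr1//.
by rewrite gt_eqF// exprn_gt0// divr_gt0.
Qed.

Lemma sum_dist (x : 'rV[R]_D.+1) (S : R) (j : nat) : 0 <= S -> (j <= D)%N ->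
  \sum_(i | e <= `|c i - x| <= S) (`|c i - x| ^+ j)^-1 <= packC * S ^+ (D - j).+1.
Proof.
move=> S0 jD.
apply: (@le_trans _ _ (S ^+ (D - j) * (packC * S))); last by rewrite exprSr mulrCA.
apply: (le_trans _ (ler_wpM2l _ (sum_dist_max x S0))); last by rewrite exprn_ge0.
rewrite mulr_sumr; apply: ler_sum => i /andP[h1 h2].
have r0 := lt_le_trans e_gt0 h1.
rewrite ler_pdivlMr ?exprn_gt0//.
have -> : `|c i - x| ^+ D = `|c i - x| ^+ (D - j) * `|c i - x| ^+ j.
  by rewrite -exprD subnK.
rewrite mulrCA mulVf ?mulr1 ?gt_eqF ?exprn_gt0//.
by apply: lerXn2r; rewrite ?nnegrE.
Qed.

End PackingSum.

Section Interaction.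
Variables (R : realType) (D : nat) (I : finType) (c : I -> 'rV[R]_D.+3) (e : R).
Hypothesis e_gt0 : 0 < e.
Hypothesis c_sep : forall i j, i != j -> 2 * e <= `|c i - c j|.
Hypothesis c_far : forall i, e <= `|c i|.

(** The points [c m] nearer to the origin than half of [`|c i|] are at distance at
    least [`|c i| / 2] from [c i], the other ones are at distance at least
    [`|c i| / 2] from the origin.  Either way one of the two factors is bounded by
    a power of [`|c i|] which exactly compensates the growth given by [sum_dist]
    for the other one: the bound does not depend on [i]. *)
Lemma interaction (i : I) (L : R) : 0 <= L ->
  \sum_(m | (m != i) && (`|c m| <= L * `|c i|))
     (`|c m| ^+ 2 * `|c m - c i| ^+ D.+1)^-1 <= packC D.+2 e * (1 + 4 * (1 + L) ^+ 2).
Proof.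
move=> L0; set rho := `|c i|; have r0 : 0 < rho := lt_le_trans e_gt0 (c_far i).
have C0 := @packC_ge0 R D.+2 e e_gt0.
rewrite (bigID (fun m => `|c m| <= rho / 2))/= mulrDr mulr1.
have sep m : m != i -> e <= `|c m - c i|.
  by move=> /c_sep; have := e_gt0; lra.
apply: lerD.
  apply: (@le_trans _ _ (\sum_(m | e <= `|c m - 0| <= rho / 2)
      (2 / rho) ^+ D.+1 * (`|c m - 0| ^+ 2)^-1)).
    rewrite big_mkcond [leRHS]big_mkcond/=; apply: ler_sum => m _.
    rewrite subr0 c_far/=; case: ifP => [/andP[/andP[mi h1] h2]|_]; last first.
      by case: ifP => // _; rewrite mulr_ge0 ?invr_ge0 ?exprn_ge0 ?divr_ge0// ltW.
    rewrite h2 invfM mulrC ler_wpM2r ?invr_ge0 ?exprn_ge0//.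
    rewrite -invf_div exprVn lef_pV2 ?posrE ?exprn_gt0 ?divr_gt0 ?(lt_le_trans e_gt0 (sep _ mi))//.
    apply: lerXn2r; rewrite ?nnegrE ?divr_ge0// ?(ltW r0)//.
    by have := ler_distD 0 (c m) (c i); rewrite subr0 sub0r normrN -/rho;
       have := lerB_dist (c i) (c m); rewrite -/rho distrC; lra.
  rewrite -mulr_sumr.
  have := @sum_dist R D.+2 I c e e_gt0 c_sep 0 (rho / 2) 2 (divr_ge0 (ltW r0) (ler0n R 2)) isT.
  rewrite !subSS subn0 => H.
  apply: (le_trans (ler_wpM2l _ H)); first by rewrite exprn_ge0// divr_ge0// ltW.
  by rewrite mulrCA -exprMn (_ : 2 / rho * (rho / 2) = 1) ?expr1n ?mulr1//; field; rewrite gt_eqF.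
apply: (@le_trans _ _ (\sum_(m | e <= `|c m - c i| <= (1 + L) * rho)
      (2 / rho) ^+ 2 * (`|c m - c i| ^+ D.+1)^-1)).
  rewrite big_mkcond [leRHS]big_mkcond/=; apply: ler_sum => m _.
  case: ifP => [/andP[/andP[mi h1] h2]|_]; last first.
    by case: ifP => // _; rewrite mulr_ge0 ?invr_ge0 ?exprn_ge0 ?divr_ge0// ltW.
  rewrite -ltNge in h2.
  have -> : (e <= `|c m - c i| <= (1 + L) * rho).
    rewrite sep//=; have := ler_normB (c m) (c i); rewrite -/rho; lra.
  rewrite invfM ler_wpM2r ?invr_ge0 ?exprn_ge0//.
  rewrite -invf_div exprVn lef_pV2 ?posrE ?exprn_gt0 ?divr_gt0 ?(lt_le_trans e_gt0 (c_far m))//.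
  by apply: lerXn2r; rewrite ?nnegrE ?divr_ge0 ?(ltW r0)// ltW.
rewrite -mulr_sumr.
have L1 : 0 <= (1 + L) * rho by rewrite mulr_ge0 ?addr_ge0// ltW.
have := @sum_dist R D.+2 I c e e_gt0 c_sep (c i) _ D.+1 L1 (leqnSn _).
rewrite subSS subSnn => H.
apply: (le_trans (ler_wpM2l _ H)); first by rewrite exprn_ge0// divr_ge0// ltW.
rewrite le_eqVlt; apply/orP; left; apply/eqP.
by move: (packC _ _) => C; field; rewrite gt_eqF.
Qed.

End Interaction.

(** * The second moment inequality for weighted visits *)

Section SecondMoment.
Variables (R : realType) (disp : measure_display) (T : measurableType disp)
  (P : probability T R).

Definition pr (A : set T) : R := fine (P A).

Lemma prE A : measurable A -> (pr A)%:E = P A.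
Proof. by move=> mA; rewrite /pr fineK// fin_num_measure. Qed.

Lemma pr_ge0 A : 0 <= pr A.
Proof. by rewrite /pr fine_ge0. Qed.

Lemma integral_indic_comb (J : finType) (u : J -> R) (E : J -> set T) :
  (forall j, 0 <= u j) -> (forall j, measurable (E j)) ->
  (\int[P]_x (\sum_j u j * \1_(E j) x)%:E)%E = (\sum_j u j * pr (E j))%:E.
Proof.
move=> u0 mE.
have mf j : measurable_fun [set: T] (fun x => (u j * \1_(E j) x)%:E).
  by apply/measurable_EFinP; apply: measurable_funM => //; exact: measurable_indic.
under eq_integral do rewrite -sumEFin.
rewrite ge0_integral_sum//; last first.
  by move=> j x _; rewrite lee_fin mulr_ge0.
rewrite -sumEFin; apply: eq_bigr => j _.
under eq_integral do rewrite EFinM.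
rewrite ge0_integralZl ?lee_fin//.
- by rewrite integral_indic// setIT EFinM prE.
- by apply/measurable_EFinP; exact: measurable_indic.
Qed.

Lemma indic_comb_le (J K : finType) (u : J -> R) (E : J -> set T)
    (v : K -> R) (F : K -> set T) :
  (forall j, 0 <= u j) -> (forall j, measurable (E j)) ->
  (forall k, 0 <= v k) -> (forall k, measurable (F k)) ->
  (forall x, \sum_j u j * \1_(E j) x <= \sum_k v k * \1_(F k) x :> R) ->
  \sum_j u j * pr (E j) <= \sum_k v k * pr (F k).
Proof.
move=> u0 mE v0 mF H.
rewrite -lee_fin -!integral_indic_comb//.
have m (L : finType) (s : L -> R) (G : L -> set T) : (forall l, measurable (G l)) ->
    measurable_fun [set: T] (fun x => (\sum_l s l * \1_(G l) x)%:E).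
  move=> mG; apply/measurable_EFinP; apply: measurable_sum => l.
  by apply: measurable_funM => //; exact: measurable_indic.
apply: ge0_le_integral => //; [|exact: m|exact: m|].
- by move=> x _; rewrite lee_fin sumr_ge0// => j _; rewrite mulr_ge0.
- by move=> x _; rewrite lee_fin.
Qed.

(** With [S] the weighted number of events [E j] that occur and [lam] its mean,
    [S] vanishes on [C], so that [lam ^+ 2 * \1_C <= (S - lam) ^+ 2]; the lemma is
    the expectation of this inequality, as in the proof of Chebyshev's
    inequality. *)
Lemma second_moment (J : finType) (w : J -> R) (E : J -> set T) (C : set T) :
  (forall j, 0 <= w j) -> (forall j, measurable (E j)) -> measurable C ->
  (forall j, C `&` E j = set0) ->
  (\sum_j w j * pr (E j)) ^+ 2 * (1 + pr C) <=
    \sum_i \sum_j w i * w j * pr (E i `&` E j).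
Proof.
move=> w0 mE mC CE; set lam := \sum_j w j * pr (E j).
have lamE : lam = \sum_j w j * pr (E j) by [].
have lam0 : 0 <= lam by apply: sumr_ge0 => j _; rewrite mulr_ge0 ?pr_ge0.
move: lam lamE lam0 => lam lamE lam0.
have prT : pr [set: T] = 1 by rewrite /pr probability_setT.
(* the inequality is written without subtraction, each side being a
   nonnegative combination of indicators *)
pose u (x : unit + J) := if x is inr j then 2 * lam * w j else lam ^+ 2.
pose U (x : unit + J) := if x is inr j then E j else C.
pose v (x : unit + J * J) := if x is inr p then w p.1 * w p.2 else lam ^+ 2.
pose V (x : unit + J * J) := if x is inr p then E p.1 `&` E p.2 else [set: T].
have key : \sum_j u j * pr (U j) <= \sum_k v k * pr (V k).
  apply: indic_comb_le.
  - by case=> [_|j] /=; rewrite ?sqr_ge0// !mulr_ge0.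
  - by case=> [_|j] /=.
  - by case=> [_|j] /=; rewrite ?sqr_ge0// mulr_ge0.
  - by case=> [_|j] /=; [exact: measurableT|exact: measurableI].
  move=> x; rewrite !big_sumType/= !(big_pred1 tt); do 2?[by case].
  rewrite -(pair_bigA _ (fun i j => w i * w j * \1_(E i `&` E j) x))/=.
  set S : R := \sum_j w j * \1_(E j) x.
  have -> : \sum_j 2 * lam * w j * \1_(E j) x = 2 * lam * S.
    by rewrite /S mulr_sumr; apply: eq_bigr => j _; rewrite mulrA.
  have -> : \sum_i \sum_j w i * w j * \1_(E i `&` E j) x = S ^+ 2.
    rewrite expr2 /S mulr_suml; apply: eq_bigr => i _.
    rewrite mulr_sumr; apply: eq_bigr => j _.
    by rewrite indicI/=; ring.
  rewrite indicT mulr1.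
  have [xC|xC] := boolP (x \in C).
    have -> : S = 0.
      apply: big1 => j _; rewrite indicE (_ : _ \in _ = false) ?mulr0//.
      apply/negP; rewrite !inE in xC *; move=> xE.
      by have : (C `&` E j) x by []; rewrite CE.
    by rewrite indicE xC /= mulr1 mulr0 addr0 expr0n addr0.
  by rewrite indicE (negbTE xC) mulr0 add0r -subr_ge0; have := sqr_ge0 (S - lam); lra.
move: key; rewrite !big_sumType/= !(big_pred1 tt); do 2?[by case].
rewrite prT -(pair_bigA _ (fun i j => w i * w j * pr (E i `&` E j)))/=.
have -> : \sum_j 2 * lam * w j * pr (E j) = 2 * lam * lam.
  by rewrite {3}lamE mulr_sumr; apply: eq_bigr => j _; rewrite mulrA.
by lra.
Qed.

End SecondMoment.

(** * Counting pairs of visits *)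

(** [p n k] is the probability of a visit to the target [n] at time [k], [p2] that
    of two visits, and [U i n m] bounds the probability of being in [m] at [i.+1]
    units of time after a visit to [n].  Thus [occ n] is the expected weight of the
    visits to [n], and [visit n m] bounds the expected weight of the visits to [m]
    which follow a visit to [n]. *)
Section PairSums.
Variables (R : realType) (I : finType) (N : nat).
Variables (w : I -> R) (p : I -> 'I_N -> R).
Variables (p2 : I * 'I_N -> I * 'I_N -> R) (U : nat -> I -> I -> R).
Hypothesis w_ge0 : forall n, 0 <= w n.
Hypothesis w_le1 : forall n, w n <= 1.
Hypothesis p_ge0 : forall n k, 0 <= p n k.
Hypothesis U_ge0 : forall i n m, 0 <= U i n m.
Hypothesis p2_sym : forall a b, p2 a b = p2 b a.
Hypothesis p2_later : forall n m (k l : 'I_N), (k < l)%N ->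
  p2 (n, k) (m, l) <= p n k * U (l - k.+1)%N n m.
Hypothesis p2_same : forall n k, p2 (n, k) (n, k) <= p n k.
Hypothesis p2_other : forall n m k, n != m -> p2 (n, k) (m, k) <= 0.

Definition occ n : R := \sum_k w n * p n k.
Definition visit n m : R := \sum_(i < N) w m * U i n m.

Lemma occ_ge0 n : 0 <= occ n.
Proof. by apply: sumr_ge0 => k _; rewrite mulr_ge0. Qed.

Lemma sum_shift (f : nat -> R) (k : 'I_N) : (forall i, 0 <= f i) ->
  \sum_(l < N | (k < l)%N) f (l - k.+1)%N <= \sum_(i < N) f i.
Proof.
move=> f0.
rewrite -(big_mkord (fun l => (k < l)%N) (fun l => f (l - k.+1)%N)).
rewrite -(big_mkord xpredT f).
rewrite (big_cat_nat _ (n := k.+1))//= ?ltn_ord//.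
rewrite big_nat_cond big_pred0 ?add0r; last first.
  by move=> i; rewrite leq0n ltnS/=; case: (leqP i k).
rewrite -{1}(add0n k.+1) big_addn.
rewrite [leRHS](big_cat_nat _ (n := (N - k.+1)%N))//= ?leq_subr//.
apply: (@le_trans _ _ (\sum_(0 <= i < N - k.+1) f i)); last first.
  by rewrite lerDl sumr_ge0.
rewrite big_mkcond/=; apply: ler_sum_nat => i _.
by rewrite addnK; case: ifP.
Qed.

(** Two visits at different times come in two orders, hence the factor [2]. *)
Lemma pair_sum_le :
  \sum_a \sum_b w a.1 * w b.1 * p2 a b <=
  \sum_n occ n + 2 * \sum_n \sum_m occ n * visit n m.
Proof.
pose F a b := w a.1 * w b.1 * p2 a b.
have Fsym a b : F a b = F b a by rewrite /F p2_sym; ring.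
have split3 : \sum_a \sum_b F a b =
    \sum_(a : I * 'I_N) \sum_(b : I * 'I_N | b.2 == a.2) F a b +
    2 * \sum_(a : I * 'I_N) \sum_(b : I * 'I_N | (a.2 < b.2)%N) F a b.
  have E : \sum_(a : I * 'I_N) \sum_(b : I * 'I_N | (b.2 < a.2)%N) F a b =
           \sum_(a : I * 'I_N) \sum_(b : I * 'I_N | (a.2 < b.2)%N) F a b.
    rewrite (exchange_big_dep xpredT)//=; apply: eq_bigr => b _.
    by apply: eq_bigr => a _; exact: Fsym.
  rewrite mulr_natl mulr2n -{1}E -!big_split/=; apply: eq_bigr => a _.
  rewrite (bigID (fun b : I * 'I_N => b.2 == a.2))/=; congr (_ + _).
  rewrite (bigID (fun b : I * 'I_N => (b.2 < a.2)%N))/=; congr (_ + _); apply: eq_bigl => b.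
    by rewrite andb_idl// => /ltn_eqF; rewrite -val_eqE => ->.
  by rewrite -leqNgt -val_eqE/= ltn_neqAle eq_sym.
rewrite [leLHS]split3; apply: lerD.
  rewrite [leLHS](_ : _ = \sum_n \sum_k \sum_(b : I * 'I_N | b.2 == k) F (n, k) b);
    last by rewrite pair_bigA; apply: eq_bigr => -[].
  apply: ler_sum => n _; apply: ler_sum => k _.
  apply: (@le_trans _ _ (F (n, k) (n, k))).
    rewrite (bigD1 (n, k))//= gerDl; apply: sumr_le0 => -[m l] /andP[/= /eqP->].
    rewrite xpair_eqE eqxx andbT eq_sym => nm.
    by rewrite /F/= mulr_ge0_le0 ?mulr_ge0// p2_other.
  rewrite /F/= -mulrA ler_wpM2l//.
  apply: (@le_trans _ _ (w n * p n k)); first by rewrite ler_wpM2l.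
  by rewrite ler_piMl.
rewrite ler_wpM2l//.
rewrite [leLHS](_ : _ = \sum_n \sum_(k < N) \sum_(b : I * 'I_N | (k < b.2)%N) F (n, k) b);
  last by rewrite pair_bigA; apply: eq_bigr => -[].
apply: ler_sum => n _; rewrite -mulr_sumr mulr_suml; apply: ler_sum => k _.
rewrite mulr_sumr.
rewrite [leLHS](_ : _ = \sum_m \sum_(l < N | (k < l)%N) F (n, k) (m, l));
  last by rewrite pair_big_dep; apply: eq_big => -[].
apply: ler_sum => m _.
apply: (@le_trans _ _ (w n * p n k * (w m * \sum_(l < N | (k < l)%N) U (l - k.+1)%N n m))).
  rewrite !mulr_sumr; apply: ler_sum => l kl.
  rewrite /F/= [leRHS](_ : _ = w n * w m * (p n k * U (l - k.+1)%N n m)); last by ring.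
  by rewrite ler_wpM2l ?mulr_ge0// p2_later.
rewrite ler_wpM2l ?mulr_ge0// /visit -mulr_sumr ler_wpM2l//.
by apply: (sum_shift (f := fun i => U i n m)).
Qed.

Variables (rho : I -> R) (L C1 C2 delta : R).
Hypothesis L_ge1 : 1 <= L.
Hypothesis rho_ge0 : forall n, 0 <= rho n.
Hypothesis visit_self : forall n, visit n n <= C1.
Hypothesis visit_near : forall n,
  \sum_(m | (m != n) && (rho m <= L * rho n)) visit n m <= C2.
Hypothesis visit_far : forall n m, L * rho n < rho m ->
  visit n m <= (1 + delta) * occ m.
Hypothesis delta_ge0 : 0 <= delta.

(** A pair of targets is far in the sense of [visit_far] in one order at most, so
    the far pairs contribute at most half of the square of [\sum_n occ n].  This
    cancels the factor [2] of [pair_sum_le], and the leading coefficient is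
    [1 + delta] rather than [2]. *)
Lemma pair_sum_le_sqr :
  \sum_a \sum_b w a.1 * w b.1 * p2 a b <=
  (1 + 2 * (C1 + C2)) * (\sum_n occ n) + (1 + delta) * (\sum_n occ n) ^+ 2.
Proof.
apply: (le_trans pair_sum_le).
suff : 2 * (\sum_n \sum_m occ n * visit n m) <=
    2 * (C1 + C2) * (\sum_n occ n) + (1 + delta) * (\sum_n occ n) ^+ 2 by lra.
have far : 2 * \sum_n \sum_(m | L * rho n < rho m) occ n * occ m <=
    (\sum_n occ n) ^+ 2.
  have E : \sum_n \sum_(m | rho m < rho n) occ n * occ m =
           \sum_n \sum_(m | rho n < rho m) occ n * occ m.
    rewrite (exchange_big_dep xpredT)//=; apply: eq_bigr => b _.
    by apply: eq_bigr => a _; exact: mulrC.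
  apply: (@le_trans _ _ (2 * \sum_n \sum_(m | rho n < rho m) occ n * occ m)).
    rewrite ler_wpM2l//; apply: ler_sum => n _.
    rewrite big_mkcond [leRHS]big_mkcond/=; apply: ler_sum => m _.
    case: ifP => h1; last by case: ifP => // _; rewrite mulr_ge0 ?occ_ge0.
    by rewrite (le_lt_trans _ h1)// ler_peMl.
  rewrite mulr_natl mulr2n -{1}E -big_split/= expr2 mulr_suml.
  apply: ler_sum => n _; rewrite mulr_sumr.
  rewrite [leRHS](bigID (fun m => rho m < rho n))/= lerD2l.
  rewrite big_mkcond [leRHS]big_mkcond/=; apply: ler_sum => m _.
  case: ifP => h1; first by rewrite ltNge (ltW h1).
  by case: ifP => // _; rewrite mulr_ge0 ?occ_ge0.
have : \sum_n \sum_m occ n * visit n m <=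
  (C1 + C2) * (\sum_n occ n) +
  (1 + delta) * \sum_n \sum_(m | L * rho n < rho m) occ n * occ m.
  rewrite !mulr_sumr -big_split/=; apply: ler_sum => n _.
  rewrite (bigID (fun m => L * rho n < rho m))/= addrC; apply: lerD.
    rewrite -mulr_sumr mulrC ler_wpM2r ?occ_ge0//.
    have [h|h] := ltP (L * rho n) (rho n).
      by have := ler_peMl (rho_ge0 n) L_ge1; rewrite leNgt h.
    rewrite (bigD1 n)/= -?leNgt//; apply: lerD => //.
    apply: le_trans (visit_near n); rewrite le_eqVlt; apply/orP; left; apply/eqP.
    by apply: eq_bigl => m; rewrite -leNgt andbC.
  rewrite mulr_sumr; apply: ler_sum => m h.
  by rewrite mulrCA ler_wpM2l ?occ_ge0// visit_far.
move=> H; apply: (le_trans (ler_wpM2l (ler0n R 2) H)).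
rewrite mulrDr mulrA lerD2l mulrCA ler_wpM2l// addr_ge0//.
Qed.

End PairSums.

(** * Visits of Brownian motion to cubes *)

Section BrownianBox.
Variables (R : realType) (d : nat).
Implicit Types (c y : 'rV[R]_d) (b s t : R).

(** Half-open, so that a cube is a disjoint union of smaller ones. *)
Definition box c b : set 'rV[R]_d :=
  [set x | forall i, c 0 i - b <= x 0 i < c 0 i + b].

Lemma borel_box c b : borel (box c b).
Proof.
pose M := g_sigma_algebraType (@open 'rV[R]_d).
have mo i a : @measurable _ M [set x : 'rV[R]_d | x 0 i < a].
  apply: sub_sigma_algebra.
  apply: (@open_comp _ _ (fun x : 'rV[R]_d => x 0 i) [set u | u < a]); last exact: open_lt.
  by move=> x _; exact: coord_continuous.
suff : @measurable _ M (box c b) by [].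
rewrite (_ : box c b = \bigcap_(i in [set: 'I_d])
    (~` [set x : 'rV[R]_d | x 0 i < c 0 i - b] `&` [set x | x 0 i < c 0 i + b])).
  apply: (@fin_bigcap_measurable _ M) => // i _.
  apply: (@measurableI _ M); last exact: mo.
  by apply: (@measurableC _ M); exact: mo.
apply/seteqP; split => [x bx i _|x bx i].
  by have /andP[h1 h2] := bx i; split=> //=; apply/negP; rewrite -leNgt.
by have [/= /negP] := bx i I; rewrite -leNgt => -> ->.
Qed.

Variables (disp : measure_display) (T : measurableType disp)
  (P : probability T R) (B : R -> T -> 'rV[R]_d).
Hypothesis BM : brownian_motion P B.

Lemma measurable_coords (f : T -> 'rV[R]_d) c b :
  (forall i, measurable_fun [set: T] (fun w => f w 0 i)) ->
  measurable [set w | box c b (f w)].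
Proof.
move=> mf; rewrite (_ : [set w | _] = \bigcap_(i in [set: 'I_d])
    ([set: T] `&` (fun w => f w 0 i) @^-1` [set` `[c 0 i - b, c 0 i + b[])).
  by apply: fin_bigcap_measurable => // i _; apply: mf => //; exact: measurable_itv.
apply/seteqP; split => [w bw i _|w bw i].
  by split => //=; rewrite in_itv/=; exact: bw.
by have [_ /=] := bw i I; rewrite in_itv.
Qed.

Lemma measurable_hit t c b : 0 <= t -> measurable [set w | box c b (B t w)].
Proof. by move=> t0; apply: measurable_coords => i; exact: (bm_measurable BM). Qed.

Lemma measurable_incr s t c b : 0 <= s -> 0 <= t ->
  measurable [set w | box c b (increment B s t w)].
Proof.
move=> s0 t0; apply: measurable_coords => i.
rewrite (_ : (fun w => _) = (fun w => B t w 0 i - B s w 0 i)).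
  by apply: measurable_funB; exact: (bm_measurable BM).
by apply/funext => w; rewrite /increment !mxE.
Qed.

Lemma P_incr s t c b : 0 <= s -> s < t ->
  P [set w | box c b (increment B s t w)] = (gbox (Num.sqrt (t - s)) c b)%:E.
Proof.
move=> s0 st.
rewrite (_ : [set w | _] = [set w | forall i,
   ([set` `[c 0 i - b, c 0 i + b[] : set R) (increment B s t w 0 i)]).
  rewrite (@bm_gaussian _ _ _ _ _ _ BM s t
    (fun i => [set` `[c 0 i - b, c 0 i + b[]))//.
  by rewrite /gbox -prodEFin; apply: eq_bigr => i _; rewrite gmass_fin.
by apply/seteqP; split => w h i; have := h i; rewrite /= in_itv.
Qed.

Lemma pr_hit t c b : 0 < t -> pr P [set w | box c b (B t w)] = gbox (Num.sqrt t) c b.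
Proof.
move=> t0; apply: EFin_inj; rewrite prE; last exact/measurable_hit/ltW.
rewrite -[t in RHS]subr0 -(P_incr c b (lexx 0) t0).
congr (P _); apply/funext => w /=.
by rewrite /increment (bm_start BM) subr0.
Qed.

Lemma pr_hit_incr s t c b c' b' : 0 < s -> s < t ->
  pr P ([set w | box c b (B s w)] `&` [set w | box c' b' (increment B s t w)]) =
  pr P [set w | box c b (B s w)] * gbox (Num.sqrt (t - s)) c' b'.
Proof.
move=> s0 st.
pose tt (k : nat) := if k == 0%N then 0 else if k == 1%N then s else t.
pose A (k : 'I_2) := if k == ord0 then box c b else box c' b'.
have inc1 w : increment B 0 s w = B s w by rewrite /increment (bm_start BM) subr0.
have := @bm_indep _ _ _ _ _ _ BM 2 tt A (lexx 0).
have h1 : forall k, (k < 2)%N -> tt k <= tt k.+1.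
  by case=> [|[|]]// _; rewrite /tt/= ltW.
have h2 : forall k, borel (A k).
  by move=> k; rewrite /A; case: ifP => _; exact: borel_box.
move=> /(_ h1 h2).
rewrite !big_ord_recl big_ord0 mule1 /A/= /tt/= => H.
rewrite (_ : _ `&` _ = [set w | forall k : 'I_2,
    (if k == ord0 then box c b else box c' b')
    (increment B (if nat_of_ord k == 0%N then 0 else if nat_of_ord k == 1%N then s else t)
       (if nat_of_ord k == 0%N then s else t) w)]); last first.
  apply/seteqP; split => [w [h3 h4] [[|[|k]] hk]//=|w h]; first by rewrite inc1.
  by split; [have := h ord0; rewrite /= inc1|exact: (h (lift ord0 ord0))].
rewrite /pr H (P_incr c' b' (ltW s0) st).
rewrite (_ : [set w | box c b (increment B 0 s w)] = [set w | box c b (B s w)]).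
  by rewrite -(prE P (measurable_hit c b (ltW s0))) -EFinM.
by apply/seteqP; split => w /=; rewrite inc1.
Qed.

(** A substitute for the Markov property at time [s].  The first cube is cut into
    cells of half-side at most [b2 - b']; when [B s] lies in a given cell, the
    increment from [s] to [t] must lie in a cube of half-side [b2] whose centre [y]
    is within [b] of [c' - c], and this increment is independent of [B s]. *)
Lemma pr_hit_hit s t c b c' b' b2 U : 0 < s -> s < t -> 0 < b -> b' < b2 ->
  (forall y, `|y - (c' - c)| <= b -> gbox (Num.sqrt (t - s)) y b2 <= U) ->
  pr P ([set w | box c b (B s w)] `&` [set w | box c' b' (B t w)]) <=
  pr P [set w | box c b (B s w)] * U.
Proof.
move=> s0 st b0 b2b HU; have t0 := lt_trans s0 st.
pose n := Num.truncn (b / (b2 - b')).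
pose e := b / n.+1%:R.
have n0 : 0 < n.+1%:R :> R by rewrite ltr0n.
have e0 : 0 < e by rewrite divr_gt0.
have eb : b' + e <= b2.
  have := truncnS_gt (b / (b2 - b')); rewrite ltr_pdivrMr ?subr_gt0// -/n => h.
  have : e <= b2 - b' by rewrite /e ler_pdivrMr// mulrC ltW.
  by lra.
have bE : b = n.+1%:R * e by rewrite /e mulrCA divff ?mulr1// gt_eqF.
pose z (v : {ffun 'I_d -> 'I_n.+1}) : 'rV[R]_d :=
  \row_i (c 0 i - b + (2 * (v i)%:R + 1) * e).
pose E v := [set w | box (z v) e (B s w)].
pose G v := [set w | box (c' - z v) b2 (increment B s t w)].
have mE v : measurable (E v) by exact/measurable_hit/ltW.
have mG v : measurable (G v) by apply: measurable_incr; exact: ltW.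
set A := [set w | box c b (B s w)]; set A' := [set w | box c' b' (B t w)].
have mA : measurable A by exact/measurable_hit/ltW.
have mA' : measurable A' by exact/measurable_hit/ltW.
have vle (v : {ffun 'I_d -> 'I_n.+1}) i : (v i)%:R + 1 <= n.+1%:R :> R.
  by rewrite -[1]/(1%:R) -natrD addn1 ler_nat.
have EA v : E v `<=` A.
  move=> w Ew i; have := Ew i; rewrite mxE => /andP[h1 h2].
  have v0 : 0 <= (v i)%:R :> R by [].
  have := ler_wpM2r (ltW e0) (vle v i); rewrite -bE.
  have := mulr_ge0 v0 (ltW e0); move: h1 h2; move: ((v i)%:R : R) => q.
  by move=> ? ? ? ?; apply/andP; split; lra.
have disj v v' w : E v w -> E v' w -> v = v'.
  move=> Ev Ev'; apply/ffunP => i; apply/val_inj.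
  have := Ev i; have := Ev' i; rewrite !mxE => /andP[h1 h2] /andP[h3 h4].
  have lt2 (p q : nat) : c 0 i - b + (2 * p%:R + 1) * e - e <= B s w 0 i ->
      B s w 0 i < c 0 i - b + (2 * q%:R + 1) * e + e -> (p <= q)%N.
    move=> h5 h6; rewrite -ltnS -(ltr_nat R) -(ltr_pM2r e0) -natr1.
    by move: (p%:R : R) (q%:R : R) h5 h6 => p' q' h5 h6; lra.
  by apply/eqP; rewrite eqn_leq (lt2 _ _ h3 h2) (lt2 _ _ h1 h4).
have cover w : A w -> exists v, E v w.
  move=> Aw; pose u i := (B s w 0 i - (c 0 i - b)) / (2 * e).
  have u0 i : 0 <= u i.
    by have /andP[h _] := Aw i; rewrite divr_ge0 ?subr_ge0// mulr_ge0// ltW.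
  have un i : (Num.truncn (u i) < n.+1)%N.
    rewrite truncn_lt_nat// ltr_pdivrMr ?mulr_gt0// mulrCA -bE.
    by have /andP[_ h] := Aw i; lra.
  exists [ffun i => Ordinal (un i)] => i; rewrite mxE ffunE/=.
  have /andP[] := truncn_itv (u0 i).
  rewrite -natr1 ler_pdivlMr ?ltr_pdivrMr ?mulr_gt0//.
  move: ((Num.truncn _)%:R : R) => q h1 h2.
  by apply/andP; split; lra.
have step w v : E v w -> A' w -> G v w.
  move=> Ew Aw' i; have := Ew i; have := Aw' i; rewrite !mxE.
  by move=> /andP[h1 h2] /andP[h3 h4]; apply/andP; split; lra.
have S1 : pr P (A `&` A') <= \sum_v 1 * pr P (E v `&` G v).
  have := @indic_comb_le _ _ _ P unit _ (fun=> 1) (fun=> A `&` A') (fun=> 1)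
    (fun v => E v `&` G v).
  rewrite (big_pred1 tt); last by case.
  rewrite mul1r; apply => //; try by move=> *; exact: measurableI.
  move=> w; rewrite (big_pred1 tt); last by case.
  rewrite mul1r [leLHS]indicE; case: (boolP (w \in _)) => [|_]; last first.
    by apply: sumr_ge0 => v _; rewrite mul1r.
  rewrite inE => -[Aw Aw']; have [v Ev] := cover w Aw.
  rewrite (bigD1 v)//= mul1r indicE mem_set ?lerDl; last by split=> //; exact: step.
  by apply: sumr_ge0 => *; rewrite mul1r.
have S2 : \sum_v 1 * pr P (E v) <= pr P A.
  have := @indic_comb_le _ _ _ P _ unit (fun=> 1) E (fun=> 1) (fun=> A).
  rewrite (big_pred1 tt); last by case.
  rewrite mul1r; apply => //.
  move=> w; rewrite (big_pred1 tt); last by case.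
  rewrite mul1r; have [[v Ev]|nE] := pselect (exists v, E v w).
    rewrite (bigD1 v)//= big1 ?addr0.
      by rewrite mul1r !indicE !mem_set//; exact: EA Ev.
    move=> v' v'v; rewrite mul1r indicE memNset// => Ev'.
    by move: v'v; rewrite (disj _ _ _ Ev Ev') eqxx.
  rewrite big1 // => v _; rewrite mul1r indicE memNset// => Ev.
  by apply: nE; exists v.
have U0 : 0 <= U.
  by apply: le_trans (HU (c' - c) _); rewrite ?gbox_ge0// subrr normr0 ltW.
apply: (le_trans S1); apply: (le_trans _ (ler_wpM2r U0 S2)).
rewrite mulr_suml; apply: ler_sum => v _; rewrite !mul1r.
rewrite pr_hit_incr// ler_wpM2l ?pr_ge0//; apply: HU.
apply: norm_le_coord; first exact: ltW.
move=> i; rewrite !mxE.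
have v0 : 0 <= (v i)%:R :> R by [].
have := ler_wpM2r (ltW e0) (vle v i); rewrite -bE.
have := mulr_ge0 v0 (ltW e0); move: ((v i)%:R : R) => q h1 h2.
by rewrite ler_norml; apply/andP; split; lra.
Qed.

End BrownianBox.

(** * Measurability of the event of never hitting the balls *)

Section NeverHitMeasurable.
Variables (R : realType) (disp : measure_display) (T : measurableType disp).

(** On a compact interval of times a continuous path which stays above [r] stays
    above [r + k.+1%:R^-1] for some [k], and by continuity the latter may be tested
    at rational times only. *)
Lemma measurable_above_all (f : R -> T -> R) (r : R) :
  (forall t, 0 <= t -> measurable_fun [set: T] (f t)) ->
  (forall w, {within `[0, +oo[, continuous (fun t => f t w)}) ->
  measurable [set w | forall t, 0 <= t -> r < f t w].
Proof.
move=> mf cf.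
pose A (m k : nat) (q : rat) : set T :=
  [set w | ((0 : R) <= ratr q <= (m%:R : R)) -> r + (k.+1%:R : R)^-1 <= f (ratr q) w].
have mA m k q : measurable (A m k q).
  rewrite /A; case: (boolP ((0 : R) <= ratr q <= (m%:R : R))) => [/andP[q0 _]|nq].
    rewrite (_ : [set w | _] =
        [set: T] `&` (f (ratr q)) @^-1` [set` `[r + (k.+1%:R : R)^-1, +oo[]).
      by apply: mf => //; exact: measurable_itv.
    apply/seteqP; split => w /=; rewrite in_itv/= andbT.
      by move=> h; split => //; exact: h.
    by move=> [].
  by rewrite (_ : [set w | _] = [set: T])//; apply/seteqP; split.
rewrite (_ : [set w | _] = \bigcap_(m in [set: nat]) \bigcup_(k in [set: nat])
    \bigcap_(q in [set: rat]) A m k q).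
  apply: bigcap_measurableType => m _; apply: bigcup_measurable => k _.
  rewrite -[X in measurable X]setCK setC_bigcap; apply: measurableC.
  by apply: bigcupT_measurable_rat => q; exact: measurableC.
apply/seteqP; split => [w H m _|w H t t0].
  have [||t0] := @EVT_min R (fun t => f t w) 0 m%:R; first exact: ler0n.
    apply: continuous_subspaceW (cf w) => x /=.
    by rewrite !in_itv/= => /andP[->].
  rewrite in_itv/= => /andP[t00 _] tmin.
  have d0 : 0 < f t0 w - r by rewrite subr_gt0 H.
  exists (Num.truncn (f t0 w - r)^-1) => // q _ qm.
  apply: (@le_trans _ _ (f t0 w)); last by apply: tmin; rewrite in_itv.
  rewrite -lerBrDl -[leRHS]invrK lef_pV2 ?posrE ?invr_gt0 ?ltr0n//.
  exact/ltW/truncnS_gt.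
pose m := (Num.truncn t).+1.
have tm : t <= m%:R by exact/ltW/truncnS_gt.
have [k _ Hk] := H m I.
have {}Hk (q : rat) : ((0 : R) <= ratr q <= (m%:R : R)) -> r + (k.+1%:R : R)^-1 <= f (ratr q) w.
  by apply: Hk.
have k0 : 0 < (k.+1%:R : R)^-1 by rewrite invr_gt0 ltr0n.
move: t0; rewrite le_eqVlt => /predU1P[<-|t0].
  by have := Hk 0; rewrite rmorph0 lexx ler0n => /(_ isT); apply: lt_le_trans; rewrite ltrDl.
rewrite ltNge; apply/negP => ftr.
have /continuous_within_itvcyP[ct _] := cf w.
have : \forall u \near t, f u w < r + (k.+1%:R : R)^-1.
  have tin : t \in `]0, +oo[ by rewrite in_itv/= t0.
  by have /cvgr_lt := ct t tin; apply; apply: (le_lt_trans ftr); rewrite ltrDl.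
move=> /nbhs_ballP[e /= e0 He].
have mt : Num.max 0 (t - e) < t by rewrite gt_max t0/= ltrBlDr ltrDl.
have [q] := rat_in_itvoo mt.
rewrite in_itv/= gt_max => /andP[/andP[q0 qe] qt].
have := Hk q; rewrite (ltW q0) (le_trans (ltW qt) tm) => /(_ isT).
apply/negP; rewrite -ltNge; apply: He.
by rewrite /ball/= gtr0_norm ?subr_gt0// ltrBlDr -ltrBlDl.
Qed.

Lemma enorm_continuous (d : nat) (c : 'rV[R]_d) :
  continuous (fun x : 'rV[R]_d => enorm (x - c)).
Proof.
have ci i : continuous (fun x : 'rV[R]_d => (x - c) 0 i).
  rewrite (_ : (fun x => _) = (fun x : 'rV[R]_d => x 0 i - c 0 i)).
    move=> x; apply: (@continuousB _ _ _ (fun x : 'rV[R]_d => x 0 i) (fun=> c 0 i)).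
      exact: coord_continuous.
    exact: cst_continuous.
  by apply/funext => x; rewrite !mxE.
move=> x; apply: (@continuous_comp _ _ _
  (fun x : 'rV[R]_d => \sum_(i < d) (x - c) 0 i ^+ 2) (@Num.sqrt R)); last first.
  exact: sqrt_continuous.
move: x; apply: continuous_big; first exact: add_continuous.
move=> i _ x; apply: (@continuousM _ _ (fun x : 'rV[R]_d => (x - c) 0 i)
  (fun x : 'rV[R]_d => (x - c) 0 i)); exact: ci.
Qed.

Lemma measurable_never_hits (d : nat) (P : probability T R) (B : R -> T -> 'rV[R]_d)
    (c : nat -> 'rV[R]_d) (r : nat -> R) :
  brownian_motion P B -> measurable (never_hits B c r).
Proof.
move=> BM.
rewrite (_ : never_hits B c r = \bigcap_(n in [set: nat])
    [set w | forall t, 0 <= t -> r n < enorm (B t w - c n)]).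
  apply: bigcap_measurableType => n _.
  apply: (measurable_above_all (f := fun t w => enorm (B t w - c n))).
    move=> t t0; rewrite /enorm.
    apply: (measurableT_comp (f := @Num.sqrt R)).
      by apply: continuous_measurable_fun; exact: sqrt_continuous.
    apply: measurable_sum => i; apply: measurable_funX.
    rewrite (_ : (fun w => _) = (fun w => B t w 0 i - c n 0 i)).
      by apply: measurable_funB => //; exact: (bm_measurable BM).
    by apply/funext => w; rewrite !mxE.
  move=> w x.
  apply: (@continuous_comp _ _ _ (from_subspace `[0, +oo[ (fun t : R => B t w))
    (fun y => enorm (y - c n)) x); first exact: (@bm_continuous _ _ _ _ _ _ BM w x).
  exact: enorm_continuous.
apply/seteqP; split => [w h n _ t t0|w h t t0 n].
  by rewrite ltNge; apply/negP; exact: h.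
by apply/negP; rewrite -ltNge; exact: h.
Qed.

End NeverHitMeasurable.

(** * The probability of avoiding finitely many balls *)

(** The cube of half-side [a i] around [c i] stands for the [i]-th ball.  The cubes
    are small compared to the separation [e] and, by a factor of order
    [theta ^+ 2], to their distance to the origin; the error of the final estimate
    tends to [0] with [theta]. *)
Section HitEstimate.
Variables (R : realType) (D : nat).
Local Notation d := D.+3.
Variables (disp : measure_display) (T : measurableType disp)
  (P : probability T R) (B : R -> T -> 'rV[R]_d).
Hypothesis BM : brownian_motion P B.
Variables (I : finType) (c : I -> 'rV[R]_d) (a : I -> R) (e M theta : R).
Hypothesis e_gt0 : 0 < e.
Hypothesis M_ge0 : 0 <= M.
Hypothesis c_sep : forall i j, i != j -> 2 * e <= `|c i - c j|.
Hypothesis c_far : forall i, e <= `|c i|.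
Hypothesis a_gt0 : forall i, 0 < a i.
Hypothesis a_e : forall i, a i <= e / 4.
Hypothesis a_theta : forall i, a i <= theta ^+ 2 * `|c i| / 2.
Hypothesis a_M : forall i, a i ^+ D.+1 * `|c i| ^+ 2 <= M.
Hypothesis theta_gt0 : 0 < theta.
Hypothesis theta_le : theta <= 1 / 2.

Let eta : R := theta ^+ 2.
(* [b2 i] leaves the room that [pr_hit_hit] requires around the cube [i] *)
Let b2 i : R := (1 + eta) * a i.
(* a time step that resolves the smallest cube: [h <= a i ^+ 2] for all [i] *)
Let h : R := (1 + \sum_i (a i ^+ 2)^-1)^-1.
(* a horizon [N%:R * h] of at least twice [`|c i| ^+ 2], which is the order of the
   time needed to reach the cube [i] *)
Let N : nat := (Num.truncn ((\sum_i 2 * `|c i| ^+ 2) / h)).+1.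

Let eta_gt0 : 0 < eta. Proof. by rewrite exprn_gt0. Qed.
Let eta_le : eta <= 1 / 4.
Proof. by rewrite /eta; have := theta_gt0; have := theta_le; nra. Qed.
Let rho_gt0 i : 0 < `|c i|. Proof. exact: lt_le_trans (c_far i). Qed.
Let b2_gt i : a i < b2 i.
Proof. by rewrite /b2 mulrDl mul1r ltrDl mulr_gt0. Qed.
Let b2_gt0 i : 0 < b2 i. Proof. exact: lt_trans (b2_gt i). Qed.
Let b2_le i : b2 i <= 2 * a i.
Proof. by rewrite /b2; have := a_gt0 i; have := eta_le; nra. Qed.
Let b2_rho i : b2 i <= eta * `|c i|.
Proof. by have := b2_le i; have := a_theta i; rewrite -/eta; lra. Qed.
Let a_rho i : a i <= `|c i| / 8.
Proof.
apply: (le_trans (a_theta i)); rewrite -/eta.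
by have := rho_gt0 i; have := eta_le; nra.
Qed.

Let h_gt0 : 0 < h.
Proof.
rewrite invr_gt0 ltr_pwDl// sumr_ge0// => i _.
by rewrite invr_ge0 sqr_ge0.
Qed.

Let h_le i : h <= a i ^+ 2.
Proof.
rewrite -[leRHS]invrK lef_pV2 ?posrE ?invr_gt0 ?exprn_gt0//.
  rewrite [X in _ <= 1 + X](bigD1 i)//= addrCA lerDl addr_ge0// sumr_ge0// => j _.
  by rewrite invr_ge0 sqr_ge0.
by rewrite -invr_gt0.
Qed.

Let N_ge i : 2 * `|c i| ^+ 2 <= N%:R * h.
Proof.
rewrite -ler_pdivrMr//; apply: le_trans (ltW (truncnS_gt _)).
have hi : 0 <= h^-1 by rewrite invr_ge0 ltW.
apply: (ler_wpM2r hi).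
by rewrite [leRHS](bigD1 i)//= lerDl sumr_ge0// => j _; rewrite mulr_ge0.
Qed.

(* with this weight the visits to [i] that follow a first one have a bounded
   expected total weight *)
Let w i : R := h / a i ^+ 2.
Let p i (k : nat) : R := gbox (Num.sqrt (gtime h k)) (c i) (a i).
Let E i (k : nat) : set T := [set x | box (c i) (a i) (B (gtime h k) x)].
Let U (k : nat) i j : R := sup [set gbox (Num.sqrt (gtime h k)) y (b2 j) |
   y in [set y | `|y - (c j - c i)| <= a i]].

Let gt0 k : 0 < gtime h k. Proof. exact: gtime_gt0. Qed.

Let U_sup k i j : has_sup [set gbox (Num.sqrt (gtime h k)) y (b2 j) |
   y in [set y | `|y - (c j - c i)| <= a i]].
Proof.
split; last by exists 1 => _ [y _ <-]; exact: gbox_le1.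
exists (gbox (Num.sqrt (gtime h k)) (c j - c i) (b2 j)); exists (c j - c i) => //=.
by rewrite subrr normr0 ltW.
Qed.

Let U_ub k i j y : `|y - (c j - c i)| <= a i ->
  gbox (Num.sqrt (gtime h k)) y (b2 j) <= U k i j.
Proof.
by move=> hy; apply: ub_le_sup; [have [] := U_sup k i j|exists y].
Qed.

Let U_le k i j m : (forall y, `|y - (c j - c i)| <= a i ->
  gbox (Num.sqrt (gtime h k)) y (b2 j) <= m) -> U k i j <= m.
Proof.
by move=> hm; apply: ge_sup; [have [] := U_sup k i j|move=> _ [y hy <-]; exact: hm].
Qed.

Let U_ge0 k i j : 0 <= U k i j.
Proof.
apply: le_trans (@U_ub k i j (c j - c i) _); first exact: gbox_ge0.
by rewrite subrr normr0 ltW.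
Qed.

Let w_ge0 i : 0 <= w i.
Proof. by rewrite divr_ge0 ?(ltW h_gt0)// sqr_ge0. Qed.

Let w_le1 i : w i <= 1.
Proof. by rewrite /w ler_pdivrMr ?exprn_gt0// mul1r. Qed.

Let mE i k : measurable (E i k).
Proof. by apply: (measurable_hit BM); exact: ltW. Qed.

Let prEi i k : pr P (E i k) = p i k.
Proof. exact: (pr_hit BM). Qed.

Let p2_later i j (k l : 'I_N) : (k < l)%N ->
  pr P (E i k `&` E j l) <= p i k * U (l - k.+1)%N i j.
Proof.
move=> kl; rewrite -prEi; apply: (pr_hit_hit BM (b2 := b2 j)) => //.
  by rewrite /gtime ltr_pM2r// ltr_nat ltnS.
move=> y hy; have <- : gtime h (l - k.+1) = gtime h l - gtime h k.
  by rewrite /gtime -mulrBl -natrB ?ltnS 1?ltnW// subSS -subSn// subSS.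
exact: U_ub.
Qed.

Let p2_other i j (k : 'I_N) : i != j -> pr P (E i k `&` E j k) <= 0.
Proof.
move=> ij; rewrite (_ : _ `&` _ = set0) ?/pr ?measure0//.
apply/seteqP; split => // x [Ei Ej].
have := c_sep ij; apply/negP; rewrite -ltNge.
apply: (@le_lt_trans _ _ e); last by have := e_gt0; lra.
apply: norm_le_coord; first exact: ltW.
move=> u; have /andP[? ?] := Ei u; have /andP[? ?] := Ej u.
have ? := a_e i; have ? := a_e j; have ? := e_gt0.
by rewrite !mxE ler_norml; apply/andP; split; lra.
Qed.

Let Kocc i : R := occ w (fun i (k : 'I_N) => p i k) i.

Lemma occE i : Kocc i = (\sum_(k < N) h * p i k) / a i ^+ 2.
Proof.
by rewrite /Kocc /occ mulr_suml; apply: eq_bigr => k _; rewrite /w mulrAC.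
Qed.

Lemma visitE i j : visit N w U i j = (\sum_(k < N) h * U k i j) / a j ^+ 2.
Proof.
by rewrite /visit mulr_suml; apply: eq_bigr => k _; rewrite /w mulrAC.
Qed.

Lemma occ_lower i : greenc R D * (a i / `|c i|) ^+ D.+1 <= Kocc i.
Proof.
rewrite occE ler_pdivlMr ?exprn_gt0//.
have := @green_ge R h h_gt0 D N `|c i| (a i) (c i) (rho_gt0 i) _ (lexx _) _ (N_ge i).
rewrite (ltW (a_gt0 i)) (le_trans (a_rho i)); last by have := rho_gt0 i; lra.
move=> /(_ isT) H; apply: le_trans (H _).
  rewrite (_ : a i ^+ d = a i ^+ D.+1 * a i ^+ 2); last by rewrite -exprD addn2.
  by rewrite expr_div_n le_eqVlt; apply/orP; left; apply/eqP; ring.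
apply: (le_trans (h_le i)).
by have := a_rho i; have := a_gt0 i; nra.
Qed.

Let C1 : R := 8 * gboxC R d.

Let gboxC_ge0 : 0 <= gboxC R d := gboxC_ge0 R d.

Lemma visit_self i : visit N w U i i <= C1.
Proof.
rewrite visitE ler_pdivrMr ?exprn_gt0//.
have H : \sum_(k < N) h * U k i i <= 2 * gboxC R d * b2 i ^+ d / b2 i ^+ D.+1.
  apply: (green_le h_gt0 (b2_gt0 i) (ltW (b2_gt0 i)) (U := fun k => U k i i)) => k _.
  apply: U_le => y _; apply: gbox_le_time => //; first exact: ltW.
  by right.
apply: (le_trans H).
rewrite (_ : b2 i ^+ d = b2 i ^+ D.+1 * b2 i ^+ 2); last by rewrite -exprD addn2.
rewrite mulrA mulrAC mulfK ?gt_eqF ?exprn_gt0//.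
have : b2 i ^+ 2 <= (2 * a i) ^+ 2.
  by apply: lerXn2r; rewrite ?nnegrE; [exact: ltW|rewrite mulr_ge0// ltW|exact: b2_le].
move=> /(ler_wpM2l gboxC_ge0) => h1.
by rewrite /C1; move: h1; rewrite exprMn; lra.
Qed.

Let K1 : R := 2 * gboxC R d * 2 ^+ d * 2 ^+ D.+1.

Lemma visit_other i j : j != i ->
  visit N w U i j <= K1 * (a j ^+ D.+1 / `|c j - c i| ^+ D.+1).
Proof.
move=> ij; have sep := c_sep ij.
have r0 : 0 < `|c j - c i| / 2 by have := e_gt0; lra.
rewrite visitE ler_pdivrMr ?exprn_gt0//.
have H : \sum_(k < N) h * U k i j <=
    2 * gboxC R d * b2 j ^+ d / (`|c j - c i| / 2) ^+ D.+1.
  apply: (green_le h_gt0 r0 (ltW (b2_gt0 j)) (U := fun k => U k i j)) => k _.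
  apply: U_le => y hy; apply: gbox_le_time => //; first exact: ltW.
  rewrite distrC in hy; have hB := lerB_dist (c j - c i) y.
  have ? := b2_le j; have ? := a_e j; have ? := a_e i; have ? := e_gt0.
  by left; split; lra.
apply: (le_trans H).
have b2d : b2 j ^+ d <= 2 ^+ d * a j ^+ d.
  rewrite -exprMn.
  by apply: lerXn2r; rewrite ?nnegrE; [exact: ltW|rewrite mulr_ge0// ltW|exact: b2_le].
apply: (@le_trans _ _ (2 * gboxC R d * (2 ^+ d * a j ^+ d) / (`|c j - c i| / 2) ^+ D.+1)).
  rewrite ler_wpM2r ?invr_ge0 ?exprn_ge0 ?(ltW r0)// ler_wpM2l// mulr_ge0//.
rewrite (_ : a j ^+ d = a j ^+ D.+1 * a j ^+ 2); last by rewrite -exprD addn2.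
rewrite le_eqVlt; apply/orP; left; apply/eqP; rewrite /K1 expr_div_n.
have : 0 < `|c j - c i| ^+ D.+1 by rewrite exprn_gt0//; lra.
have : 0 < 2 ^+ D.+1 :> R by rewrite exprn_gt0.
move: (_ ^+ D.+1) (2 ^+ D.+1) (2 ^+ d) (gboxC _ _) (a j ^+ D.+1) => q2 q1 q3 q4 q5 h1 h2.
by field; rewrite !gt_eqF.
Qed.


(* the cubes farther than [L * `|c i|] hardly distinguish the cube [i] from the
   origin *)
Let L : R := 2 / eta.

Let C2 : R := K1 * M * (packC D.+2 e * (1 + 4 * (1 + L) ^+ 2)).

Let K1_ge0 : 0 <= K1.
Proof.
exact: (mulr_ge0 (mulr_ge0 (mulr_ge0 (ler0n R 2) gboxC_ge0)
  (exprn_ge0 d (ler0n R 2))) (exprn_ge0 D.+1 (ler0n R 2))).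
Qed.

Let L_ge1 : 1 <= L.
Proof. by rewrite /L ler_pdivlMr// mul1r; have := eta_le; lra. Qed.

(** The hypothesis [a_M] turns the factor [a j ^+ D.+1] of [visit_other] into
    [`|c j| ^- 2], and then the sum over [j] is that of [interaction]. *)
Lemma visit_near i :
  \sum_(j | (j != i) && (`|c j| <= L * `|c i|)) visit N w U i j <= C2.
Proof.
apply: (le_trans _ (ler_wpM2l (mulr_ge0 K1_ge0 M_ge0)
  (interaction e_gt0 c_sep c_far i (le_trans ler01 L_ge1)))).
rewrite mulr_sumr; apply: ler_sum => j /andP[ji _].
apply: (le_trans (visit_other ji)); rewrite -mulrA ler_wpM2l//.
have q0 : 0 < `|c j - c i| ^+ D.+1.
  by rewrite exprn_gt0//; have := c_sep ji; have := e_gt0; lra.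
rewrite invfM mulrA ler_wpM2r ?invr_ge0 ?(ltW q0)//.
by rewrite ler_pdivlMr ?exprn_gt0.
Qed.

Definition hit_slope : R := gboxC R d * 4 ^+ d / greenc R D.

Lemma hit_slope_ge0 : 0 <= hit_slope.
Proof.
exact: divr_ge0 (mulr_ge0 gboxC_ge0 (exprn_ge0 d (ler0n R 4))) (ltW (greenc_gt0 R D)).
Qed.

(** The excess over [1] of the ratio of the Green functions of a distant cube, seen
    from a nearer cube and from the origin. *)
Definition hit_error : R := expR (4 * d%:R * theta) - 1 + hit_slope * theta.

(** Started from the cube [i] instead of the origin, Brownian motion has nearly the
    same Green function at the cube [j]: the times up to [theta * `|c j| ^+ 2] are
    negligible by [green_short], and later the masses of the cube [j] seen from
    the two starting points are almost equal by [gbox_cmp]. *)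
Lemma visit_far i j : L * `|c i| < `|c j| ->
  visit N w U i j <= (1 + hit_error) * Kocc j.
Proof.
move=> ij; set rho := `|c j|.
have ri : `|c i| <= eta * rho / 2.
  move: ij; rewrite /L mulrAC ltr_pdivrMr// -/rho => ij.
  by rewrite mulrC in ij; lra.
have near y : `|y - (c j - c i)| <= a i -> `|y - c j| <= eta * rho.
  move=> hy; have -> : y - c j = (y - (c j - c i)) - c i by rewrite opprB addrA addrAC addrK.
  apply: (le_trans (ler_normB _ _)).
  by have := a_rho i; have := rho_gt0 i; lra.
have r0 : 0 < rho by exact: rho_gt0.
have er : eta * rho <= rho / 4 by have := eta_le; nra.
have pj0 k : 0 <= p j k by exact: gbox_ge0.
have r20 : 0 < rho / 2 by rewrite divr_gt0.
pose F := expR (4 * d%:R * theta).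
have long k : theta * rho ^+ 2 <= gtime h k -> U k i j <= F * p j k.
  move=> hk; apply: U_le => y hy.
  have s0 : 0 < Num.sqrt (gtime h k) by rewrite sqrtr_gt0.
  have := @gbox_cmp R d _ (c j) y (a j) (b2 j) rho eta s0 (a_gt0 j) (ltW (b2_gt0 j)) (ltW r0).
  have e1 : 0 <= eta <= 2 / 3 by rewrite (ltW eta_gt0)/=; have := eta_le; lra.
  have e2 : a j <= eta * rho by apply: le_trans (b2_rho j); exact: ltW.
  move=> /(_ e1 e2 (b2_rho j) (lexx _) (near y hy)) /le_trans; apply.
  rewrite ler_wpM2r ?gbox_ge0// /F.
  have -> : b2 j / a j = 1 + eta by rewrite /b2 mulfK// gt_eqF.
  have -> : 4 * d%:R * theta = d%:R * theta + d%:R * (3 * theta) by ring.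
  rewrite expRD ler_pM ?exprn_ge0 ?expR_ge0//.
  - by rewrite addr_ge0// ltW.
  - rewrite expRM_natl; apply: lerXn2r; rewrite ?nnegrE ?expR_ge0//.
      by rewrite addr_ge0// ltW.
    apply: (le_trans _ (expR_ge1Dx _)); rewrite lerD2l.
    by rewrite /eta; have := theta_gt0; have := theta_le; nra.
  rewrite ler_expR ler_wpM2l// -mulrA ler_wpM2l//.
  rewrite expr_div_n sqr_sqrtr ?(ltW (gt0 _))//.
  rewrite mulrA ler_pdivrMr//.
  by rewrite /eta expr2 -mulrA ler_wpM2l// ltW.
have short : \sum_(k < N | gtime h k < theta * rho ^+ 2) h * U k i j <=
    gboxC R d * (b2 j / (rho / 2)) ^+ d * (theta * rho ^+ 2).
  have tr0 : 0 <= theta * rho ^+ 2 by rewrite mulr_ge0 ?sqr_ge0 ?(ltW theta_gt0).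
  apply: (green_short h_gt0 r20 (ltW (b2_gt0 j)) tr0 (U := fun k => U k i j)) => k _.
  apply: U_le => y hy; apply: gbox_le_time => //; first exact: ltW.
  have hB := lerB_dist (c j) y; rewrite distrC -/rho in hB.
  have ? := near y hy; have hb := b2_rho j; rewrite -/rho in hb.
  by left; split; lra.
rewrite visitE ler_pdivrMr ?exprn_gt0//.
rewrite (bigID (fun k : 'I_N => gtime h k < theta * rho ^+ 2))/= addrC.
have -> : 1 + hit_error = F + hit_slope * theta by rewrite /hit_error /F; ring.
rewrite 2!mulrDl; apply: lerD.
  rewrite occE -mulrA divfK ?gt_eqF ?exprn_gt0// mulr_sumr.
  rewrite big_mkcond/=; apply: ler_sum => k _; rewrite -leNgt.
  case: ifP => hk; last by rewrite !mulr_ge0 ?expR_ge0 ?(ltW h_gt0).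
  by rewrite mulrCA ler_wpM2l ?(ltW h_gt0)// long.
apply: (le_trans short).
have g0 := greenc_gt0 R D.
have occ1 : hit_slope * theta * (greenc R D * (a j / rho) ^+ D.+1) * a j ^+ 2 <=
    hit_slope * theta * Kocc j * a j ^+ 2.
  rewrite ler_wpM2r ?sqr_ge0// ler_wpM2l ?occ_lower//.
  by apply: mulr_ge0; [exact: hit_slope_ge0|exact: ltW].
apply: le_trans occ1.
have b2d : (b2 j / (rho / 2)) ^+ d <= (4 * (a j / rho)) ^+ d.
  apply: lerXn2r; rewrite ?nnegrE.
  - by apply: divr_ge0; exact: ltW.
  - by rewrite mulr_ge0// divr_ge0// ltW.
  rewrite ler_pdivrMr//.
  by rewrite (_ : _ * (rho / 2) = 2 * a j) ?b2_le//; field; rewrite gt_eqF.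
apply: (@le_trans _ _ (gboxC R d * (4 * (a j / rho)) ^+ d * (theta * rho ^+ 2))).
  apply: ler_wpM2r; first by rewrite mulr_ge0 ?sqr_ge0 ?(ltW theta_gt0).
  exact: ler_wpM2l.
rewrite exprMn (_ : (a j / rho) ^+ d = (a j / rho) ^+ D.+1 * (a j / rho) ^+ 2);
  last by rewrite -exprD addn2.
rewrite le_eqVlt; apply/orP; left; apply/eqP.
rewrite /hit_slope [(a j / rho) ^+ 2]expr_div_n.
move: (4 ^+ d) (gboxC _ _) ((a j / rho) ^+ D.+1) => q1 q2 q3.
by field; rewrite !gt_eqF.
Qed.

Lemma hit_error_ge0 : 0 <= hit_error.
Proof.
rewrite addr_ge0//.
  rewrite subr_ge0 -expR0 ler_expR !mulr_ge0// ltW//.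
by apply: mulr_ge0; [exact: hit_slope_ge0|exact: ltW].
Qed.

Definition hit_const : R := 1 + 2 * (C1 + C2).

Lemma hit_const_ge0 : 0 <= hit_const.
Proof.
have C10 : 0 <= C1 by exact: mulr_ge0.
have C20 : 0 <= C2.
  have q : 0 <= 1 + 4 * (1 + L) ^+ 2 by rewrite addr_ge0// mulr_ge0// sqr_ge0.
  exact: (mulr_ge0 (mulr_ge0 K1_ge0 M_ge0) (mulr_ge0 (@packC_ge0 R D.+2 e e_gt0) q)).
by rewrite /hit_const; lra.
Qed.

(** Since [second_moment] and [pair_sum_le_sqr] bound
    [lam ^+ 2 * (1 + pr P C)] by [hit_const * lam + (1 + hit_error) * lam ^+ 2],
    a [C] of probability larger than the error bounds the mean weight [lam],
    and hence the sum by [occ_lower].  The constants do not depend on the number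
    of balls. *)
Lemma hit_estimate (C : set T) : measurable C ->
  (forall i t, 0 <= t -> C `&` [set x | box (c i) (a i) (B t x)] = set0) ->
  (pr P C - hit_error) * (greenc R D * \sum_i (a i / `|c i|) ^+ D.+1) <= hit_const \/
  pr P C <= hit_error.
Proof.
move=> mC CE; have [|eC] := leP (pr P C) hit_error; first by right.
left.
pose lam := \sum_i Kocc i.
have Kocc0 i : 0 <= Kocc i.
  by apply: sumr_ge0 => k _; rewrite mulr_ge0// gbox_ge0.
have lam0 : 0 <= lam by exact: sumr_ge0.
have lamE : lam = \sum_(x : I * 'I_N) w x.1 * pr P (E x.1 x.2).
  rewrite /lam /Kocc /occ pair_bigA; apply: eq_bigr => x _.
  by rewrite prEi.
have H1 := @second_moment R _ _ P _ (fun x : I * 'I_N => w x.1)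
  (fun x => E x.1 x.2) C (fun x => w_ge0 _) (fun x => mE _ _) mC (fun x => CE _ _ (ltW (gt0 _))).
have H2 := @pair_sum_le_sqr R I N w (fun i (k : 'I_N) => p i k)
  (fun x y => pr P (E x.1 x.2 `&` E y.1 y.2)) U w_ge0 w_le1
  (fun i k => gbox_ge0 _ _ _) U_ge0.
have {}H2 := H2 (fun x y => congr1 _ (setIC _ _)) (fun i j k l => @p2_later i j k l).
have p2_same i (k : 'I_N) : pr P (E i k `&` E i k) <= p i k by rewrite setIid prEi.
have {}H2 := H2 p2_same (fun i j k => @p2_other i j k).
have {}H2 := H2 (fun i => `|c i|) L C1 C2 hit_error L_ge1 (fun i => normr_ge0 _)
  visit_self visit_near visit_far hit_error_ge0.
have H3 := le_trans H1 H2.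
rewrite -lamE -/lam in H3.
have H4 : (pr P C - hit_error) * lam <= hit_const.
  move: lam0; rewrite le_eqVlt => /predU1P[<-|lam0].
    by rewrite mulr0; exact: hit_const_ge0.
  rewrite -(ler_pM2r lam0).
  move: H3; rewrite -/hit_const.
  by lra.
apply: le_trans H4; rewrite ler_wpM2l ?subr_ge0 ?(ltW eC)//.
by rewrite mulr_sumr; apply: ler_sum => i _; exact: occ_lower.
Qed.

End HitEstimate.

(** * From cubes to balls and from finite families to the series *)

Section Norms.
Variables (R : realType) (d : nat).
Implicit Types x c : 'rV[R]_d.

Lemma norm_le_enorm x : `|x| <= enorm x.
Proof.
apply: norm_le_coord; first exact: sqrtr_ge0.
move=> i; rewrite -sqrtr_sqr /enorm ler_wsqrtr//.
by rewrite (bigD1 i)//= lerDl sumr_ge0// => j _; exact: sqr_ge0.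
Qed.

Lemma enorm_le_norm x : enorm x <= d%:R * `|x|.
Proof.
have [d0|d0] := posnP d.
  rewrite /enorm big1 ?sqrtr0 ?mulr_ge0//.
  by move=> i; have := ltn_ord i; rewrite {2}d0.
have r0 : 0 <= d%:R * `|x| by rewrite mulr_ge0.
rewrite -[leRHS]ger0_norm// -sqrtr_sqr /enorm ler_wsqrtr// exprMn.
apply: (@le_trans _ _ (d%:R * `|x| ^+ 2)).
  have -> : d%:R * `|x| ^+ 2 = \sum_(i < d) `|x| ^+ 2.
    by rewrite sumr_const card_ord mulr_natl.
  apply: ler_sum => i _.
  by rewrite -(real_normK (num_real (x 0 i))) ler_sqr ?nnegrE// norm_coord_le.
by rewrite ler_wpM2r ?sqr_ge0// ler_eXnr// ler1n.
Qed.

Lemma box_sub_cball c r : 0 <= r -> box c (r / d%:R) `<=` cball c r.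
Proof.
move=> r0 x bx; rewrite /cball/=.
have [d0|d0] := posnP d.
  by rewrite /enorm big1 ?sqrtr0// => i; have := ltn_ord i; rewrite {2}d0.
apply: (le_trans (enorm_le_norm _)).
have dr : 0 < d%:R :> R by rewrite ltr0n.
rewrite mulrC -ler_pdivlMr//; apply: norm_le_coord; first by rewrite divr_ge0.
move=> i; have /andP[h1 h2] := bx i.
by rewrite !mxE ler_norml; apply/andP; split; lra.
Qed.

End Norms.

Lemma hit_error_small (R : realType) (D : nat) (eps : R) : 0 < eps ->
  exists theta : R, [/\ 0 < theta, theta <= 1 / 2 & hit_error D theta <= eps].
Proof.
move=> eps0; set d := D.+3; set K := hit_slope R D.
have K0 : 0 <= K := hit_slope_ge0 R D.
have d1 : 1 <= d%:R :> R by rewrite ler1n.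
have dK : 0 < 8 * d%:R + K by lra.
pose theta := Num.min (1 / (8 * d%:R)) (eps / (8 * d%:R + K)).
have t0 : 0 < theta by rewrite lt_min !divr_gt0//; lra.
have t1 : theta <= 1 / (8 * d%:R) by rewrite ge_min lexx.
have t2 : theta <= eps / (8 * d%:R + K) by rewrite ge_min lexx orbT.
have x2 : 4 * d%:R * theta <= 1 / 2.
  by move: t1; rewrite ler_pdivlMr; lra.
exists theta; split => //.
  by nra.
rewrite /hit_error -/d -/K.
set x := 4 * d%:R * theta in x2 *.
have x0 : 0 <= x by rewrite /x !mulr_ge0// ltW.
(* expR x <= 1 / (1 - x) <= 1 + 2 * x *)
have ex : expR x <= 1 + 2 * x.
  have : 1 - x <= expR (- x) by exact: expR_ge1Dx.
  rewrite expRN => h; have e0 := expR_gt0 x.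
  have : (1 - x) * expR x <= 1.
    by rewrite -ler_pdivlMr// mul1r.
  by nra.
move: t2; rewrite ler_pdivlMr//; move: ex; rewrite {2}/x; lra.
Qed.

(** [theta] is chosen so that the error of [hit_estimate] is at most half of the
    probability of avoidance, and the estimate is applied to the balls that are
    far enough for this [theta].  The other balls have their centres within a
    bounded distance [R1] of the origin, because [r n ^+ D.+1 * `|c n| ^+ 2 <= M]
    forces distant balls to be small; by [card_packing] their number is bounded,
    and each of them contributes at most [D.+3%:R ^+ D.+1] to the sum. *)
Lemma balls_series_bounded (R : realType) (D : nat) (c : nat -> 'rV[R]_D.+3)
    (r : nat -> R) (e M : R) :
  (forall n, 0 < r n) -> 0 < e ->
  (forall n m, n != m -> 2 * e <= `|c n - c m|) ->
  (forall n, r n ^+ D.+1 * `|c n| ^+ 2 <= M) ->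
  (forall n, r n <= D.+3%:R * `|c n|) ->
  avoidable c r ->
  exists K : R, forall N, \sum_(n < N) (r n / `|c n|) ^+ D.+1 <= K.
Proof.
set d := D.+3 => r0 e0 sep rM rd [disp [T [P [B [BM Cpos]]]]].
set C := never_hits B c r in Cpos.
have mC : measurable C := measurable_never_hits c r BM.
have p0 : 0 < pr P C by rewrite -lte_fin prE.
have [theta [t0 t2 tp]] := @hit_error_small R D (pr P C / 2) (divr_gt0 p0 (ltr0Sn _ 1)).
have M0 : 0 <= M.
  by apply: le_trans (rM 0%N); rewrite mulr_ge0 ?exprn_ge0// ltW.
have dr : 1 <= d%:R :> R by rewrite ler1n.
have d0 : 0 < d%:R :> R by lra.
pose a n := r n / d%:R.
have a0 n : 0 < a n by rewrite divr_gt0.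
have ar n : a n <= r n by rewrite ler_pdivrMr// ler_peMr// ltW.
have rho0 n : 0 < `|c n|.
  by rewrite -(pmulr_rgt0 _ d0); exact: lt_le_trans (rd n).
pose good n := [&& e <= `|c n|, a n <= e / 4 & a n <= theta ^+ 2 * `|c n| / 2].
pose S := M / (e / 4) ^+ D.+1.
have S0 : 0 <= S by rewrite divr_ge0// exprn_ge0// divr_ge0// ltW.
pose R1 := 1 + S + e + e / theta ^+ 2.
have et0 : 0 < e / theta ^+ 2 by rewrite divr_gt0// exprn_gt0.
have badR n : ~~ good n -> `|c n - 0| <= R1.
  rewrite subr0 leNgt; apply: contra => hn; rewrite /good.
  have h1 : e <= `|c n| by move: hn; rewrite /R1; lra.
  have h2 : a n <= e / 4.
    rewrite leNgt; apply/negP => ha.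
    have h3 : (e / 4) ^+ D.+1 * `|c n| ^+ 2 <= M.
      apply: le_trans (rM n); rewrite ler_wpM2r ?sqr_ge0//.
      have e4 : 0 <= e / 4 by rewrite divr_ge0// ltW.
      apply: lerXn2r; rewrite ?nnegrE ?(ltW (r0 n))//.
      exact: le_trans (ltW ha) (ar n).
    have h4 : `|c n| ^+ 2 <= S.
      by rewrite ler_pdivlMr ?exprn_gt0 ?divr_gt0// mulrC.
    (* [`|c n| ^+ 2 <= S] entails [`|c n| <= 1 + S] *)
    have h5 : 1 + S < `|c n| by move: hn; rewrite /R1; lra.
    by move: h4 h5 S0; nra.
  rewrite h1 h2/=; apply: (le_trans h2).
  have : e / theta ^+ 2 <= `|c n| by move: hn; rewrite /R1; lra.
  rewrite ler_pdivrMr ?exprn_gt0// mulrC; lra.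
have eR1 : e <= R1 by rewrite /R1; lra.
have g0 := greenc_gt0 R D.
exists (d%:R ^+ D.+1 * (hit_const D e M theta / (pr P C / 2 * greenc R D)) +
  (3 * R1 / e) ^+ d * d%:R ^+ D.+1) => N.
rewrite (bigID (fun n : 'I_N => good n))/=; apply: lerD.
  have -> : \sum_(n < N | good n) (r n / `|c n|) ^+ D.+1 =
     d%:R ^+ D.+1 * \sum_(n < N | good n) (a n / `|c n|) ^+ D.+1.
    rewrite mulr_sumr; apply: eq_bigr => n _; rewrite -exprMn; congr (_ ^+ _).
    by rewrite /a; field; rewrite !gt_eqF.
  apply: ler_wpM2l; first by rewrite exprn_ge0// ltW.
  pose A : {pred 'I_N} := [pred n : 'I_N | good n].
  have -> : \sum_(n < N | good n) (a n / `|c n|) ^+ D.+1 =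
      \sum_(n : {n | n \in A}) (a (val n) / `|c (val n)|) ^+ D.+1.
    exact: (big_sub A (fun n : 'I_N => (a n / `|c n|) ^+ D.+1)).
  have goodA (n : {n | n \in A}) : good (val n) by exact: (valP n).
  have := @hit_estimate R D disp T P B BM _ (fun n : {n | n \in A} => c (val n))
    (fun n => a (val n)) e M theta e0 M0.
  have h1 (i j : {n | n \in A}) : i != j -> 2 * e <= `|c (val i) - c (val j)|.
    by move=> ij; apply: sep.
  have h2 (i : {n | n \in A}) : e <= `|c (val i)|.
    by have /and3P[] := goodA i.
  have h3 (i : {n | n \in A}) : a (val i) <= e / 4.
    by have /and3P[] := goodA i.
  have h4 (i : {n | n \in A}) : a (val i) <= theta ^+ 2 * `|c (val i)| / 2.
    by have /and3P[] := goodA i.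
  have h5 (i : {n | n \in A}) : a (val i) ^+ D.+1 * `|c (val i)| ^+ 2 <= M.
    apply: le_trans (rM (val i)); rewrite ler_wpM2r ?sqr_ge0//.
    by apply: lerXn2r; rewrite ?nnegrE ?(ltW (r0 _)) ?(ltW (a0 _)).
  move=> /(_ h1 h2 (fun i => a0 _) h3 h4 h5 t0 t2 C mC) [].
  - move=> i t tge0; apply/seteqP; split => // x [Cx bx].
    by apply: (Cx t tge0 (val i)); apply: box_sub_cball bx; exact: ltW.
  - set s := \sum_i _ => H.
    have pg : 0 < pr P C / 2 * greenc R D by rewrite (mulr_gt0 _ g0)// divr_gt0.
    rewrite (ler_pdivlMr _ _ pg).
    apply: le_trans H.
    have -> : s * (pr P C / 2 * greenc R D) = pr P C / 2 * (greenc R D * s) by ring.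
    have s0 : 0 <= s.
      by apply: sumr_ge0 => i _; rewrite exprn_ge0// divr_ge0// ltW.
    have gs : 0 <= greenc R D * s by exact: mulr_ge0 (ltW g0) s0.
    apply: (ler_wpM2r gs); lra.
  by move=> h; exfalso; lra.
apply: (@le_trans _ _ (\sum_(n in [pred n : 'I_N | `|c n - 0| <= R1]) d%:R ^+ D.+1)).
  rewrite big_mkcond [leRHS]big_mkcond/=; apply: ler_sum => n _; rewrite inE.
  case: ifP => [/badR ->|_].
    apply: lerXn2r; rewrite ?nnegrE ?(ltW d0)//; first by rewrite divr_ge0// ltW.
    by rewrite ler_pdivrMr.
  by case: ifP => // _; rewrite exprn_ge0// ltW.
rewrite sumr_const -[leLHS]mulr_natl ler_wpM2r ?exprn_ge0 ?(ltW d0)//.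
by apply: (card_packing (c := fun n : 'I_N => c n) e0) => // i j ij; exact: sep.
Qed.

Unset Implicit Arguments.

Theorem theorem1 (R : realType) (d : nat) (d_ge3 : (3 <= d)%N)
    (c : nat -> 'rV[R]_d) (r : nat -> R)
    (r_gt0 : forall n, 0 < r n)
    (balls_disjoint : trivIset [set: nat] (fun n => cball (c n) (r n)))
    (Omega_region : region (~` \bigcup_n cball (c n) (r n)))
    (Omega0 : (~` \bigcup_n cball (c n) (r n)) 0)
    (separated : exists eps : R, 0 < eps /\
       forall n m : nat, n <> m -> 2 * eps <= enorm (c n - c m))
    (bounded : exists M : R,
       forall n : nat, r n ^+ (d - 2) * enorm (c n) ^+ 2 <= M)
    (balls_avoidable : avoidable c r) :
  (\sum_(0 <= n <oo) ((r n / enorm (c n)) ^+ (d - 2))%:E < +oo)%E.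
Proof.
case: d d_ge3 c balls_disjoint Omega_region Omega0 separated bounded balls_avoidable
  => [|[|[|D]]]// _ c _ _ Omega0 [eps [eps0 sep]] [M bd] av.
rewrite !subSS subn0 in bd *.
have d0 : 0 < D.+3%:R :> R by rewrite ltr0n.
have r_lt n : r n < enorm (c n).
  rewrite ltNge; apply/negP => h; apply: Omega0; exists n => //.
  rewrite /cball/= (_ : enorm (0 - c n) = enorm (c n))//.
  by congr Num.sqrt; apply: eq_bigr => i _; rewrite !mxE sub0r sqrrN.
have rd n : r n <= D.+3%:R * `|c n|.
  exact: le_trans (ltW (r_lt n)) (enorm_le_norm _).
have rho0 n : 0 < `|c n|.
  by rewrite -(pmulr_rgt0 _ d0); exact: lt_le_trans (rd n).
have [|||K HK] := @balls_series_bounded R D c r (eps / D.+3%:R) M r_gt0 _ _ _ rd av.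
- by rewrite divr_gt0.
- move=> n m /eqP nm; rewrite mulrA ler_pdivrMr// [leRHS]mulrC.
  exact: le_trans (sep n m nm) (enorm_le_norm _).
- move=> n; apply: le_trans (bd n); rewrite ler_wpM2l ?exprn_ge0 ?(ltW (r_gt0 n))//.
  by apply: lerXn2r; rewrite ?nnegrE ?sqrtr_ge0 ?norm_le_enorm.
apply: (@le_lt_trans _ _ K%:E); last exact: ltry.
apply: lime_le.
  by apply: is_cvg_nneseries => n _ _; rewrite lee_fin exprn_ge0// divr_ge0 ?sqrtr_ge0// ltW.
apply: nearW => N; rewrite sumEFin lee_fin big_mkord.
apply: le_trans (HK N); apply: ler_sum => n _.
have en : 0 < enorm (c n) := lt_trans (r_gt0 n) (r_lt n).
apply: lerXn2r; rewrite ?nnegrE ?divr_ge0 ?(ltW en) ?(ltW (r_gt0 n))//.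
by rewrite ler_wpM2l ?(ltW (r_gt0 n))// lef_pV2 ?posrE// norm_le_enorm.
Qed.
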